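(* Let $M=\mathbb{C}^{n-k}/\Gamma$ be a compact complex torus, let $E=\bigoplus_{p=1}^kL_p$ with each $L_p=L(H_p,\alpha_p)$ a line bundle over $M$, and let $X$ be the total space of $E$. Then $X$ admits a complete flat K\''ahler metric if and only if $H_p=0$ for all $p=1,\dots,k$. In particular, if $k=1$ (with $M$ an elliptic curve, $n=2$), the complete flat K\''ahler metrics on $X$ are characterized as follows: the K\''ahler form of any complete flat K\''ahler metric on $X$ is $$\omega=\sqrt{-1}\Big[c\,d(z+h_1(\xi))\wedge d\overline{(z+h_1(\xi))}+|h_2(\xi)|^2\,d\xi\wedge d\bar\xi\Big]$$ for some constant $c>0$ and holomorphic functions $h_1,h_2$ on $\mathbb{C}$ with $h_2$ nowhere vanishing, where $(z,\xi)$ are the coordinates on $X$ descended from those on $\mathbb{C}^2$.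
   Context: Let $M=V/\Gamma$ be a compact complex torus ($V$ a finite-dimensional complex vector space, $\Gamma\subset V$ a lattice of full rank), $H$ a Hermitian form on $V$ (complex linear in the first argument) with $\operatorname{Im}H$ $\mathbb{Z}$-valued on $\Gamma\times\Gamma$, and $\alpha:\Gamma\to S^1$ with $\alpha(\gamma_1+\gamma_2)=e^{i\pi\operatorname{Im}H(\gamma_1,\gamma_2)}\alpha(\gamma_1)\alpha(\gamma_2)$. The line bundle $L(H,\alpha)$ over $M$ is the quotient of $V\times\mathbb{C}$ by the action of $\gamma\in\Gamma$: $(z,\xi)\mapsto(z+\gamma,\alpha(\gamma)e^{\pi H(z,\gamma)+\frac{\pi}{2}H(\gamma,\gamma)}\xi)$. *)

(* Defs.v *)
From HB Require Import structures.
From mathcomp Require Import all_boot all_order all_algebra.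
From mathcomp Require Import sesquilinear.
From mathcomp Require Import all_classical all_reals all_analysis.
From mathcomp Require Import complex.

Set Implicit Arguments.
Unset Strict Implicit.
Unset Printing Implicit Defensive.

Import Order.TTheory GRing.Theory Num.Theory.
Import numFieldNormedType.Exports.

Local Open Scope classical_set_scope.
Local Open Scope ring_scope.

(* Riemannian geometry in global coordinates: a metric on R^d is its Gram
   matrix function g, with g x i j the value of the metric at x on the i-th and
   j-th coordinate fields. *)
Section Riemannian.
Variables (R : realType) (d : nat).
Implicit Types (f : 'rV[R]_d -> R) (g : 'rV[R]_d -> 'M[R]_d).

Definition partial (i : 'I_d) f : 'rV[R]_d -> R := 'D_(delta_mx 0 i) f.

Fixpoint Ck (r : nat) f : Prop :=
  continuous f /\
  (if r is r'.+1 then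
     forall i, (forall x, derivable f x (delta_mx 0 i)) /\ Ck r' (partial i f)
   else True).

Definition smooth f := forall r, Ck r f.

Definition inner g (x u v : 'rV[R]_d) : R := (u *m g x *m v^T) 0 0.

Definition riemannian_metric g : Prop :=
  [/\ forall i j, smooth (fun x => g x i j),
      forall x, (g x)^T = g x
    & forall x u, u != 0 -> 0 < inner g x u u].

(* Christoffel symbol Gamma^k_{ij} of the Levi-Civita connection. *)
Definition christoffel g (i j k : 'I_d) (x : 'rV[R]_d) : R :=
  2^-1 * \sum_l invmx (g x) k l *
    (partial i (fun y => g y j l) x + partial j (fun y => g y i l) x
     - partial l (fun y => g y i j) x).

(* Riemann curvature component R^l_{ijk}, i.e. the l-th coordinate of
   R(e_i, e_j) e_k. *)
Definition curvature g (i j k l : 'I_d) (x : 'rV[R]_d) : R :=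
  partial i (christoffel g j k l) x - partial j (christoffel g i k l) x
  + \sum_p (christoffel g j k p x * christoffel g i p l x
            - christoffel g i k p x * christoffel g j p l x).

Definition flat g : Prop := forall i j k l x, curvature g i j k l x = 0.

Definition geodesic g (c : R -> 'rV[R]_d) : Prop :=
  [/\ forall t, derivable c t 1,
      forall t, derivable (derive1 c) t 1
    & forall t k, derive1 (derive1 c) t 0 k =
        - \sum_i \sum_j christoffel g i j k (c t) * derive1 c t 0 i * derive1 c t 0 j].

(* Every geodesic extends to the whole real line. *)
Definition geodesically_complete g : Prop :=
  forall x v, exists c, [/\ geodesic g c, c 0 = x & derive1 c 0 = v].

End Riemannian.

(* C^N is identified with R^(2N) by z |-> (Re z, Im z). *)
Section Kahler.
Variables (R : realType) (N : nat).
Local Notation C := R[i].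
Implicit Types (g : 'rV[R]_(N + N) -> 'M[R]_(N + N)).

Definition to_complex (x : 'rV[R]_(N + N)) : 'rV[C]_N :=
  \row_j (lsubmx x 0 j +i* rsubmx x 0 j)%C.

Definition to_real (z : 'rV[C]_N) : 'rV[R]_(N + N) :=
  row_mx (\row_j complex.Re (z 0 j)) (\row_j complex.Im (z 0 j)).

(* Multiplication by i; vectors are rows, so it acts on the right:
   (x, y) *m Jmx = (- y, x). *)
Definition Jmx : 'M[R]_(N + N) := block_mx 0 1%:M (- 1%:M) 0.

(* omega(u, v) = g(J u, v); for the Euclidean metric this is
   \sum_j dx_j /\ dy_j = (i / 2) \sum_j dz_j /\ d(conj z_j). *)
Definition kahler_form g (x u v : 'rV[R]_(N + N)) : R :=
  inner g x (u *m Jmx) v.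

Definition closed2 (w : 'rV[R]_(N + N) -> 'rV[R]_(N + N) -> 'rV[R]_(N + N) -> R)
    : Prop :=
  forall (i j k : 'I_(N + N)) x,
    let e l := delta_mx 0 l : 'rV[R]_(N + N) in
    partial i (fun y => w y (e j) (e k)) x
    + partial j (fun y => w y (e k) (e i)) x
    + partial k (fun y => w y (e i) (e j)) x = 0.

Definition kahler_metric g : Prop :=
  [/\ riemannian_metric g,
      forall x u v, inner g x (u *m Jmx) (v *m Jmx) = inner g x u v
    & closed2 (kahler_form g)].

(* Differential of a complex-valued function, as a complex-valued 1-form. *)
Definition cdiff (f : 'rV[R]_(N + N) -> C) (x u : 'rV[R]_(N + N)) : C :=
  ('D_u (fun y => complex.Re (f y)) x +i* 'D_u (fun y => complex.Im (f y)) x)%C.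

Definition wedge (a b : 'rV[R]_(N + N) -> C) (u v : 'rV[R]_(N + N)) : C :=
  a u * b v - a v * b u.

End Kahler.

Definition cexp (R : realType) (z : R[i]) : R[i] :=
  (expR (complex.Re z) * cos (complex.Im z)
   +i* (expR (complex.Re z) * sin (complex.Im z)))%C.

Definition holomorphic (R : realType) (h : R[i] -> R[i]) : Prop :=
  let K : numFieldType := R[i] in
  forall z : K, derivable (h : K^o -> K^o) z 1.

Section LineBundles.
Variables (R : realType) (m : nat).
Local Notation C := R[i].
Local Notation V := 'rV[C]_m.
Local Notation herm := {hermitian V for false & @Num.conj C}.

Definition lattice (Gamma : set V) : Prop :=
  exists b : 'I_(m + m) -> V,
    (forall t : 'I_(m + m) -> R,
        \sum_i (t i)%:C%C *: b i = 0 -> forall i, t i = 0) /\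
    Gamma = [set \sum_i b i *~ a i | a in [set: 'I_(m + m) -> int]].

Definition appell_humbert (Gamma : set V) (H : herm) (alpha : V -> C) : Prop :=
  [/\ forall g1 g2, Gamma g1 -> Gamma g2 -> complex.Im (H g1 g2) \is a Num.int,
      forall g1, Gamma g1 -> `|alpha g1| = 1
    & forall g1 g2, Gamma g1 -> Gamma g2 ->
        alpha (g1 + g2) =
        cexp ('i%C * (pi * complex.Im (H g1 g2))%:C%C) * alpha g1 * alpha g2].

Variable k : nat.
Implicit Types (H : 'I_k -> herm) (alpha : 'I_k -> V -> C).

(* The action of g1 on C^m x C^k whose quotient is the total space of the sum
   of the line bundles L(H_p, alpha_p). *)
Definition deck H alpha (g1 : V) (y : 'rV[C]_(m + k)) : 'rV[C]_(m + k) :=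
  let z := lsubmx y in let xi := rsubmx y in
  row_mx (z + g1)
    (\row_p (alpha p g1
             * cexp (pi%:C%C * H p z g1 + (pi / 2)%:C%C * H p g1 g1) * xi 0 p)).

Definition deck_real H alpha (g1 : V) (x : 'rV[R]_((m + k) + (m + k))) :=
  to_real (deck H alpha g1 (to_complex x)).

(* The total space X is the quotient of C^(m+k) by the free and properly
   discontinuous action of Gamma through deck, so a metric on X is a metric g on
   C^(m+k) invariant under that action. Being Kahler or flat is local, and the
   geodesics of X are the projections of those of g, so each property holds on X
   exactly when it holds for g. *)
Definition complete_flat_kahler (Gamma : set V) H alpha
    (g : 'rV[R]_((m + k) + (m + k)) -> 'M[R]_((m + k) + (m + k))) : Prop :=
  [/\ forall g1, Gamma g1 -> forall x u v,
        inner g (deck_real H alpha g1 x)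
          ('d (deck_real H alpha g1) x u) ('d (deck_real H alpha g1) x v)
        = inner g x u v,
      kahler_metric g, flat g & geodesically_complete g].

End LineBundles.

(* Main.v *)
(* On C^(m+k) a flat Kahler metric g has a connection matrix Gamma_v, linear in v,
   commuting with J and satisfying Gamma_(vJ) = Gamma_v J; flatness then gives
   D_v Gamma_v + D_(vJ) Gamma_(vJ) = 0.  Hence for a constant vector w the Laplacian
   of g(w, w) along a complex line is a sum of squared lengths, and the same holds
   for the dual metric on covectors.

   Let u(z) be the squared g-length, at the point (z, 0) of the zero section, of the
   p-th fibre direction.  Invariance under the deck group says that
   u(z) exp(pi H_p(z, z)) is Gamma-periodic, hence bounded, while for the dual metric
   exp(pi H_p) is replaced by exp(-pi H_p).  A subharmonic function on the plane
   that is bounded above is constant, so neither function can decay along a complex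
   line: H_p(v, v) is neither positive nor negative.  No completeness is used.

   If H = 0 the deck group acts by unitary affine maps, so g(w, w) is bounded, hence
   constant, along the z-lines, and Gamma vanishes in the z-direction.  Therefore g
   depends on xi only, c0 = g(d_z, d_z) is constant, and with p = g(d_z, d_xi),
   q = g(d_z, J d_xi), r = g(d_xi, d_xi) the function (p - i q) / c0 is holomorphic
   in xi, with primitive h1, and the logarithm of rho = r - (p^2 + q^2) / c0 is
   harmonic, so that rho / 2 = |h2|^2 for a zero-free holomorphic h2. *)
Require Import Defs.
From HB Require Import structures.
From mathcomp Require Import all_boot all_order all_algebra.
From mathcomp Require Import sesquilinear.
From mathcomp Require Import all_classical all_reals all_analysis.
From mathcomp Require Import complex.
From mathcomp Require Import ring lra.

Set Implicit Arguments.
Unset Strict Implicit.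
Unset Printing Implicit Defensive.

Import Order.TTheory GRing.Theory Num.Theory.
Import numFieldNormedType.Exports.

Local Open Scope classical_set_scope.
Local Open Scope ring_scope.

(** * Directional derivatives *)

(** Vectors are rows and matrices act from the right, so products appear in the reverse of the usual
    order. When [H] is not zero the deck maps are not affine: their differential also differentiates
    the exponential factor. That extra term carries a factor [xi] and disappears on the zero
    section, where the differential is a complex diagonal matrix; hence the sign argument looks at
    the metric only there. The minus transposed connection matrices belong to the dual metric and
    satisfy the same two quadratic and differential identities, so one Bochner formula and one decay
    argument serve both signs. A recurring obstacle is that [Ck] speaks of partial derivatives only:
    first-order estimates must be recovered from the mean value theorem before a direction can vary
    linearly or a complex derivative can be formed. In rank one, [h1] is chosen so that d(z + h1)
    kills the orthogonal complement of the z-line, which completes the square in [g]; the derivative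
    of log h2 is the Christoffel coefficient of the xi-direction along itself. The halves in c0 / 2
    and rho / 2 come from i dz /\ d(conj z) = 2 dx /\ dy. *)

Section LineCalculus.
Variables (R : realType) (V : normedModType R).
Implicit Types (f : V -> R) (x u v : V).

Lemma is_derive_line f x v (s l : R) :
  is_derive (x + s *: v) v f l -> is_derive s 1 (fun t => f (x + t *: v)) l.
Proof.
have E : (fun h : R => h^-1 *: (((fun t => f (x + t *: v)) \o shift s) (h *: 1)
    - f (x + s *: v))) =
  (fun h : R => h^-1 *: ((f \o shift (x + s *: v)) (h *: v) - f (x + s *: v))).
  apply/funext => h /=; congr (_ *: (f _ - _)).
  by rewrite [h *: 1]mulr1 scalerDl addrCA.
by case=> d1 d2; apply: DeriveDef; rewrite /derivable /derive E.
Qed.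

Lemma is_derive_dirZ f x v (a l : R) :
  is_derive x v f l -> is_derive x (a *: v) f (a * l).
Proof.
move=> [/derivable1P d1 d2].
have d3 : is_derive (0 : R) 1 (fun h : R => f (h *: v + x)) l.
  apply: DeriveDef => //; rewrite -d2 /derive.
  set g1 := fun h : R => h^-1 *: _; set g2 := fun h : R => h^-1 *: _.
  suff -> : g1 = g2 by [].
  apply/funext => h; rewrite /g1 /g2 /=.
  by rewrite addr0 scale0r add0r [h *: 1]mulr1.
have da : is_derive (0 : R) 1 (fun h : R => h * a) a.
  have := @is_deriveM R R id (cst a) 0 1 1 0 _ _.
  by rewrite scaler0 add0r [_ *: 1]mulr1; apply.
have d4 : is_derive (0 : R) 1 ((fun h : R => f (h *: v + x)) \o (fun h => h * a)) (a * l).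
  by rewrite mulrC; apply: is_derive1_comp; rewrite mul0r.
have E : (fun h : R => h^-1 *: ((f \o shift x) (h *: (a *: v)) - f x)) =
  (fun h : R => h^-1 *: ((((fun h : R => f (h *: v + x)) \o (fun h => h * a)) \o shift 0) (h *: 1)
   - ((fun h : R => f (h *: v + x)) \o (fun h => h * a)) 0)).
  apply/funext => h /=.
  by rewrite addr0 mul0r scale0r add0r [h *: 1]mulr1 scalerA.
by case: d4 => d4 d5; apply: DeriveDef; rewrite /derivable /derive E.
Qed.

(** Directional derivatives alone need not add up. The displacement [h *: (u + v)] is split into a
    leg along [v], covered by derivability at [x], and a leg along [u] from the moved point, where
    the mean value theorem and the continuity of ['D_u f] control the quotient. *)
Lemma is_derive_dirD f x u v :
  (forall y, derivable f y u) -> continuous ('D_u f) -> derivable f x v ->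
  is_derive x (u + v) f ('D_u f x + 'D_v f x).
Proof.
move=> du cu dv.
suff H : (fun h : R => h^-1 *: ((f \o shift x) (h *: (u + v)) - f x)) @ 0^' -->
         ('D_u f x + 'D_v f x).
  by apply: DeriveDef; [apply/cvg_ex; eexists; exact: H | apply/cvg_lim].
have -> : (fun h : R => h^-1 *: ((f \o shift x) (h *: (u + v)) - f x)) =
  (fun h : R => h^-1 *: (f (x + h *: v + h *: u) - f (x + h *: v)) +
      h^-1 *: ((f \o shift x) (h *: v) - f x)).
  apply/funext => h /=; rewrite -scalerDr; congr (_ *: _).
  rewrite [h *: v + x]addrC addrA subrK.
  by rewrite scalerDr [X in X + x]addrC [X in f X]addrC addrA.
apply: cvgD; last exact: dv.
apply/cvgrPdist_le => e e0.
have /cvgrPdist_le/(_ e e0) := cu x.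
move=> /nbhs_ballP [dl /= dl0 B].
(* The extra 1 keeps [M] positive when [u] and [v] vanish, so that [dl / M] is a usable radius. *)
have [M M0 HM] : exists2 M : R, 0 < M & `|v| + `|u| <= M.
  exists (`|v| + `|u| + 1); last by rewrite lerDl.
  by rewrite ltr_wpDl // addr_ge0.
near=> h.
have h0 : h != 0 by near: h; exact: nbhs_dnbhs_neq.
have hs : `|h| < dl / M.
  by near: h; apply: dnbhs0_lt; rewrite divr_gt0.
have D t : is_derive t (1 : R) (fun s => f (x + h *: v + s *: u))
              ('D_u f (x + h *: v + t *: u)).
  by apply: is_derive_line; apply: derivableP.
have Dc (A : set R) : {within A, continuous (fun s => f (x + h *: v + s *: u))}.
  apply: continuous_subspaceT => t; apply: differentiable_continuous.
  by apply/derivable1_diffP; case: (D t).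
have [c ch E] : exists2 c : R, `|c| <= `|h| &
   f (x + h *: v + h *: u) - f (x + h *: v) = 'D_u f (x + h *: v + c *: u) * h.
  have [h_ge0|h_lt0] := leP 0 h.
    have [c] := @MVT_segment R (fun s => f (x + h *: v + s *: u))
      (fun t => 'D_u f (x + h *: v + t *: u)) 0 h h_ge0 (fun t _ => D t) (Dc _).
    rewrite in_itv /= scale0r addr0 subr0 => /andP[c0 c1] ->; exists c => //.
    by rewrite !ger0_norm.
  have [c] := @MVT_segment R (fun s => f (x + h *: v + s *: u))
    (fun t => 'D_u f (x + h *: v + t *: u)) h 0 (ltW h_lt0) (fun t _ => D t) (Dc _).
  rewrite in_itv /= scale0r addr0 sub0r => /andP[c0 c1] /eqP.
  rewrite mulrN -opprB eqr_opp => /eqP ->; exists c => //.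
  by rewrite !ler0_norm ?lerN2 // ltW.
rewrite E [_ *: _]mulrC mulfK //.
apply: B; rewrite -ball_normE /ball_ /=.
rewrite -addrA opprD addNKr normrN.
apply: (le_lt_trans (ler_normD _ _)); rewrite !normrZ.
apply: (@le_lt_trans _ _ (`|h| * (`|v| + `|u|))).
  by rewrite mulrDr lerD2l ler_wpM2r.
apply: (@le_lt_trans _ _ (`|h| * M)); first by rewrite ler_wpM2l.
by rewrite -ltr_pdivlMr.
Unshelve. all: by end_near. Qed.

End LineCalculus.

Section SmoothFunctions.
Variables (R : realType) (d : nat).
Local Notation V := 'rV[R]_d.
Implicit Types (f g : V -> R) (x u v : V).

(* The type annotation fixes the semiring structure of [R] in [delta_mx], which
   unification otherwise compares at great cost. *)
Definition evec (i : 'I_d) : V := (delta_mx 0 i : 'rV[R]_d).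

Lemma partialE i f x : partial i f x = 'D_(evec i) f x.
Proof. by []. Qed.

Lemma row_sum_evec v : v = \sum_i v 0 i *: evec i.
Proof. exact: row_sum_delta. Qed.

Lemma Ck_continuous r f : Ck r f -> continuous f.
Proof. by case: r => [|r] []. Qed.

Lemma CkW r f : Ck r.+1 f -> Ck r f.
Proof.
elim: r f => [|r IH] f; first by case=> cf _; split.
by case=> cf H; split => // i; have [H1 H2] := H i; split => //; exact: IH.
Qed.

Lemma Ck_cst r (a : R) : Ck r (fun _ : V => a).
Proof.
elim: r a => [|r IH] a; split=> //; try exact: cst_continuous.
move=> i; split=> [x|]; first exact: derivable_cst.
suff -> : partial i (fun _ : V => a) = fun=> 0 by exact: IH.
by apply/funext => x; exact: derive_cst.
Qed.

Lemma CkD r f g : Ck r f -> Ck r g -> Ck r (fun x => f x + g x).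
Proof.
elim: r f g => [|r IH] f g [cf Hf] [cg Hg]; split => //;
  try by move=> x; apply: continuousD; [exact: cf|exact: cg].
move=> i; have [df Cf] := Hf i; have [dg Cg] := Hg i.
split=> [x|]; first exact: derivableD.
suff -> : partial i (fun x => f x + g x) = fun x => partial i f x + partial i g x.
  exact: IH.
by apply/funext => x; exact: deriveD.
Qed.

Lemma CkM r f g : Ck r f -> Ck r g -> Ck r (fun x => f x * g x).
Proof.
elim: r f g => [|r IH] f g [cf Hf] [cg Hg]; split => //;
  try by move=> x; apply: continuousM; [exact: cf|exact: cg].
move=> i; have [df Cf] := Hf i; have [dg Cg] := Hg i.
split=> [x|]; first exact: derivableM.
suff -> : partial i (fun x => f x * g x) =
    fun x => f x * partial i g x + g x * partial i f x.
  by apply: CkD; apply: IH => //; apply: CkW; split.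
by apply/funext => x; exact: deriveM.
Qed.

Lemma CkV r f : (forall x, f x != 0) -> Ck r f -> Ck r (fun x => (f x)^-1).
Proof.
move=> f0; elim: r => [|r IH] [cf Hf]; split => //;
  try by move=> x; apply: continuousV; [exact: f0|exact: cf].
move=> i; have [df Cf] := Hf i.
split=> [x|]; first exact: derivableV.
suff -> : partial i (fun x => (f x)^-1) =
    fun x => (-1) * ((f x)^-1 * (f x)^-1) * partial i f x.
  have CV : Ck r (fun x => (f x)^-1) by apply: IH; apply: CkW; split.
  by apply: CkM => //; apply: CkM; [exact: Ck_cst|exact: CkM].
apply/funext => x; rewrite /partial deriveV // mulN1r.
by rewrite [_ *: _]/(_ * _) expr2 invfM.
Qed.

Lemma smooth_cst (a : R) : smooth (fun _ : V => a).
Proof. by move=> r; exact: Ck_cst. Qed.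

Lemma smoothD f g : smooth f -> smooth g -> smooth (fun x => f x + g x).
Proof. by move=> Hf Hg r; exact: CkD. Qed.

Lemma smoothM f g : smooth f -> smooth g -> smooth (fun x => f x * g x).
Proof. by move=> Hf Hg r; exact: CkM. Qed.

Lemma smoothV f : (forall x, f x != 0) -> smooth f -> smooth (fun x => (f x)^-1).
Proof. by move=> f0 Hf r; exact: CkV. Qed.

Lemma smoothN f : smooth f -> smooth (fun x => - f x).
Proof.
move=> Hf; under eq_fun do rewrite -mulN1r.
by apply: smoothM => //; exact: smooth_cst.
Qed.

Lemma smooth_sum (I : Type) (s : seq I) (P : pred I) (F : I -> V -> R) :
  (forall i, smooth (F i)) -> smooth (fun x => \sum_(i <- s | P i) F i x).
Proof.
move=> HF; elim: s => [|i s IH].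
  by under eq_fun do rewrite big_nil; exact: smooth_cst.
under eq_fun do rewrite big_cons; case: (P i) => //.
exact: smoothD.
Qed.

Lemma smooth_prod (I : Type) (s : seq I) (P : pred I) (F : I -> V -> R) :
  (forall i, smooth (F i)) -> smooth (fun x => \prod_(i <- s | P i) F i x).
Proof.
move=> HF; elim: s => [|i s IH].
  by under eq_fun do rewrite big_nil; exact: smooth_cst.
under eq_fun do rewrite big_cons; case: (P i) => //.
exact: smoothM.
Qed.

Lemma smooth_continuous f : smooth f -> continuous f.
Proof. by move/(_ 0%N)/Ck_continuous. Qed.

Lemma smooth_partial f i : smooth f -> smooth (partial i f).
Proof. by move=> H r; have [_ /(_ i) []] := H r.+1. Qed.

(** Coordinates are added one at a time: the new summand is always a multiple of a coordinate
    vector, and for these the continuity asked for by [is_derive_dirD] is part of [Ck 1]. *)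
Lemma Ck1_is_derive f x v : Ck 1 f ->
  is_derive x v f (\sum_i v 0 i * partial i f x).
Proof.
move=> Hf; have [_ H] := Hf.
suff G (s : seq 'I_d) y : is_derive y (\sum_(i <- s) v 0 i *: evec i) f
    (\sum_(i <- s) v 0 i * partial i f y).
  by rewrite {1}(row_sum_evec v); exact: G.
elim: s y => [|i s IH] y; first by rewrite !big_nil; exact: is_derive0.
have E z : 'D_(v 0 i *: evec i) f z = v 0 i * partial i f z.
  by have [] := is_derive_dirZ (v 0 i) (derivableP (proj1 (H i) z)).
rewrite !big_cons -E; have [dIH <-] := IH y; apply: is_derive_dirD; last exact: dIH.
- move=> z.
  by have [] := is_derive_dirZ (v 0 i) (derivableP (proj1 (H i) z)).
- move=> z; rewrite (_ : 'D_ _ f = fun z => v 0 i * partial i f z); last exact/funext.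
  apply: continuousM; first exact: cst_continuous.
  exact: (proj1 (proj2 (H i))).
Qed.

Lemma smooth_is_derive f x v : smooth f ->
  is_derive x v f (\sum_i v 0 i * partial i f x).
Proof. by move/(_ 1%N)/Ck1_is_derive. Qed.

Lemma smooth_derivable f x v : smooth f -> derivable f x v.
Proof. by move=> /(@smooth_is_derive _ x v) []. Qed.

Lemma smooth_deriveE f x v : smooth f -> 'D_v f x = \sum_i v 0 i * partial i f x.
Proof. by move=> /(@smooth_is_derive _ x v) []. Qed.

Lemma smooth_derive f v : smooth f -> smooth ('D_v f).
Proof.
move=> Hf; rewrite (_ : 'D_v f = fun x => \sum_i v 0 i * partial i f x).
  apply: smooth_sum => i; apply: smoothM; first exact: smooth_cst.
  exact: smooth_partial.
by apply/funext => x; exact: smooth_deriveE.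
Qed.

Lemma smooth_deriveD f x u v : smooth f -> 'D_(u + v) f x = 'D_u f x + 'D_v f x.
Proof.
move=> Hf; rewrite !smooth_deriveE // -big_split; apply: eq_bigr => i _.
by rewrite mxE mulrDl.
Qed.

Lemma smooth_deriveZ f x a v : smooth f -> 'D_(a *: v) f x = a * 'D_v f x.
Proof.
move=> Hf; rewrite !smooth_deriveE // mulr_sumr; apply: eq_bigr => i _.
by rewrite mxE mulrA.
Qed.

End SmoothFunctions.

Section SmoothMatrices.
Variables (R : realType) (d : nat).
Local Notation V := 'rV[R]_d.

Definition smooth_mx m n (A : V -> 'M[R]_(m, n)) :=
  forall i j, smooth (fun x => A x i j).

Lemma smooth_mx_derivable m n (A : V -> 'M[R]_(m, n)) x v :
  smooth_mx A -> derivable A x v.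
Proof. by move=> HA; apply/derivable_mxP => i j; exact: smooth_derivable. Qed.

Lemma derive_mxE m n (A : V -> 'M[R]_(m, n)) x v i j : smooth_mx A ->
  'D_v A x i j = 'D_v (fun y => A y i j) x.
Proof. by move=> HA; rewrite derive_mx ?mxE //; exact: smooth_mx_derivable. Qed.

Lemma smooth_mx_cst m n (A : 'M[R]_(m, n)) : smooth_mx (fun _ : V => A).
Proof. by move=> i j; exact: smooth_cst. Qed.

Lemma smooth_mxN m n (A : V -> 'M[R]_(m, n)) :
  smooth_mx A -> smooth_mx (fun x => - A x).
Proof. by move=> HA i j; under eq_fun do rewrite mxE; exact: smoothN. Qed.

Lemma smooth_mxZ m n (a : R) (A : V -> 'M[R]_(m, n)) :
  smooth_mx A -> smooth_mx (fun x => a *: A x).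
Proof.
move=> HA i j; under eq_fun do rewrite mxE.
by apply: smoothM => //; exact: smooth_cst.
Qed.

Lemma smooth_mx_sum (I : Type) (s : seq I) m n (A : I -> V -> 'M[R]_(m, n)) :
  (forall i, smooth_mx (A i)) -> smooth_mx (fun x => \sum_(i <- s) A i x).
Proof.
move=> HA i j; under eq_fun do rewrite summxE.
by apply: smooth_sum => k; exact: HA.
Qed.

Lemma smooth_mxM m n p (A : V -> 'M[R]_(m, n)) (B : V -> 'M[R]_(n, p)) :
  smooth_mx A -> smooth_mx B -> smooth_mx (fun x => A x *m B x).
Proof.
move=> HA HB i j; under eq_fun do rewrite mxE.
by apply: smooth_sum => k; exact: smoothM.
Qed.

Lemma smooth_trmx m n (A : V -> 'M[R]_(m, n)) :
  smooth_mx A -> smooth_mx (fun x => (A x)^T).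
Proof. by move=> HA i j; under eq_fun do rewrite mxE; exact: HA. Qed.

Lemma smooth_det n (A : V -> 'M[R]_n) : smooth_mx A -> smooth (fun x => \det (A x)).
Proof.
move=> HA; rewrite /determinant; apply: smooth_sum => s.
apply: smoothM; first exact: smooth_cst.
by apply: smooth_prod => i; exact: HA.
Qed.

Lemma smooth_invmx n (A : V -> 'M[R]_n) :
  (forall x, A x \in unitmx) -> smooth_mx A -> smooth_mx (fun x => invmx (A x)).
Proof.
move=> UA HA i j.
under eq_fun do rewrite /invmx UA mxE mxE /cofactor.
apply: smoothM.
  by apply: smoothV; [move=> x; have := UA x; rewrite unitmxE unitfE | exact: smooth_det].
apply: smoothM; first exact: smooth_cst.
apply: smooth_det => k l.
by under eq_fun do rewrite !mxE; exact: HA.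
Qed.

Lemma derive_mulmx m n p (A : V -> 'M[R]_(m, n)) (B : V -> 'M[R]_(n, p)) x v :
  smooth_mx A -> smooth_mx B ->
  'D_v (fun y => A y *m B y) x = 'D_v A x *m B x + A x *m 'D_v B x.
Proof.
move=> HA HB; apply/matrixP => i j.
rewrite derive_mxE; last exact: smooth_mxM.
under [in LHS]eq_fun do rewrite mxE.
have -> : (fun y => \sum_k A y i k * B y k j) = \sum_k (fun y => A y i k * B y k j).
  by apply/funext => y; rewrite fct_sumE.
rewrite derive_sum => [|k]; last first.
  by apply: derivableM; exact: smooth_derivable.
rewrite !mxE -big_split /=; apply: eq_bigr => k _.
rewrite (@deriveM R V (fun y => A y i k) (fun y => B y k j));
  [|exact: smooth_derivable|exact: smooth_derivable].
rewrite !derive_mxE // addrC; congr (_ + _); exact: mulrC.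
Qed.

Lemma derive_trmx m n (A : V -> 'M[R]_(m, n)) x v :
  smooth_mx A -> 'D_v (fun y => (A y)^T) x = ('D_v A x)^T.
Proof.
move=> HA; apply/matrixP => i j.
rewrite derive_mxE; last exact: smooth_trmx.
by rewrite mxE derive_mxE //; under [in LHS]eq_fun do rewrite mxE.
Qed.

Lemma derive_mxD m n (A : V -> 'M[R]_(m, n)) x u v : smooth_mx A ->
  'D_(u + v) A x = 'D_u A x + 'D_v A x.
Proof.
move=> HA; apply/matrixP => i j; rewrite [RHS]mxE.
rewrite (derive_mxE x (u + v) i j HA) (derive_mxE x u i j HA) (derive_mxE x v i j HA).
exact: smooth_deriveD.
Qed.

Lemma derive_mxZ m n (A : V -> 'M[R]_(m, n)) x a v : smooth_mx A ->
  'D_(a *: v) A x = a *: 'D_v A x.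
Proof.
by move=> HA; apply/matrixP => i j; rewrite mxE !derive_mxE // smooth_deriveZ.
Qed.

End SmoothMatrices.

(** * The Levi-Civita connection *)

Section LinearForms.
Variables (R : realType) (d : nat).
Local Notation V := 'rV[R]_d.

(** A bare predicate, so that it applies directly to functions obtained by freezing all but one
    argument of a tensor; tensor identities are then checked on [evec]. *)
Definition linear_form (f : V -> R) :=
  (forall u v, f (u + v) = f u + f v) /\ (forall a u, f (a *: u) = a * f u).

Lemma linear_form_coord f v : linear_form f ->
  f v = \sum_i v 0 i * f (evec R i).
Proof.
move=> [fD fZ]; rewrite {1}(row_sum_evec v).
elim: (index_enum _) => [|i s IH]; last by rewrite !big_cons fD fZ IH.
by rewrite !big_nil -(scale0r 0) fZ mul0r.
Qed.

Lemma linear_form0 f v : linear_form f -> (forall i, f (evec R i) = 0) -> f v = 0.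
Proof.
by move=> lf H; rewrite (linear_form_coord _ lf) big1 // => i _; rewrite H mulr0.
Qed.

Lemma linear_formD f g : linear_form f -> linear_form g ->
  linear_form (fun v => f v + g v).
Proof.
move=> [fD fZ] [gD gZ]; split=> [u v|a u]; first by rewrite fD gD addrACA.
by rewrite fZ gZ mulrDr.
Qed.

Lemma linear_formZ f a : linear_form f -> linear_form (fun v => a * f v).
Proof.
move=> [fD fZ]; split=> [u v|b u]; first by rewrite fD mulrDr.
by rewrite fZ mulrCA.
Qed.

Lemma linear_formN f : linear_form f -> linear_form (fun v => - f v).
Proof.
move=> [fD fZ]; split=> [u v|b u]; first by rewrite fD opprD.
by rewrite fZ mulrN.
Qed.

Lemma linear_form_mulmx f (A : 'M[R]_d) : linear_form f ->
  linear_form (fun v => f (v *m A)).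
Proof.
move=> [fD fZ]; split=> [u v|b u]; first by rewrite mulmxDl fD.
by rewrite -scalemxAl fZ.
Qed.

Lemma eq_mx_rows m (A B : 'M[R]_(d, m)) : (forall v : V, v *m A = v *m B) -> A = B.
Proof. by move=> H; apply/row_matrixP => i; rewrite !rowE H. Qed.

End LinearForms.

Section LeviCivita.
Variables (R : realType) (d : nat).
Local Notation V := 'rV[R]_d.
Implicit Types (g : V -> 'M[R]_d) (u v w x : V).

Lemma innerE g x u v : inner g x u v = (u *m g x *m v^T) 0 0.
Proof. by []. Qed.

Lemma innerDl g x u v w : inner g x (u + v) w = inner g x u w + inner g x v w.
Proof. by rewrite /inner !mulmxDl mxE. Qed.

Lemma innerZl g x a u w : inner g x (a *: u) w = a * inner g x u w.
Proof. by rewrite /inner -!scalemxAl mxE. Qed.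

Lemma innerDr g x u v w : inner g x w (u + v) = inner g x w u + inner g x w v.
Proof. by rewrite /inner linearD mulmxDr mxE. Qed.

Lemma innerZr g x a u w : inner g x w (a *: u) = a * inner g x w u.
Proof. by rewrite /inner linearZ -scalemxAr mxE. Qed.

Lemma innerNl g x u w : inner g x (- u) w = - inner g x u w.
Proof. by rewrite -scaleN1r innerZl mulN1r. Qed.

Lemma innerNr g x u w : inner g x w (- u) = - inner g x w u.
Proof. by rewrite -scaleN1r innerZr mulN1r. Qed.

Lemma inner0l g x w : inner g x 0 w = 0.
Proof. by rewrite -(scale0r 0) innerZl mul0r. Qed.

Lemma inner0r g x w : inner g x w 0 = 0.
Proof. by rewrite -(scale0r 0) innerZr mul0r. Qed.

Lemma inner_linear_l g x w : linear_form (fun u => inner g x u w).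
Proof. by split=> [u v|a u]; [exact: innerDl | exact: innerZl]. Qed.

Lemma inner_linear_r g x w : linear_form (fun u => inner g x w u).
Proof. by split=> [u v|a u]; [exact: innerDr | exact: innerZr]. Qed.

Lemma inner_delta g x i j : inner g x (evec R i) (evec R j) = g x i j.
Proof. by rewrite /inner /evec trmx_delta -colE -rowE !mxE. Qed.

Lemma innerC g x u v : (g x)^T = g x -> inner g x u v = inner g x v u.
Proof.
move=> gs; rewrite /inner -[in RHS](trmxK (v *m g x *m u^T)) [RHS]mxE.
by rewrite !trmx_mul trmxK gs mulmxA.
Qed.

Lemma smooth_inner g u v : smooth_mx g -> smooth (fun x => inner g x u v).
Proof.
move=> sg; apply: (smooth_mxM (A := fun x => u *m g x) (B := fun=> v^T)).
  by apply: smooth_mxM => //; exact: smooth_mx_cst.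
exact: smooth_mx_cst.
Qed.

Lemma derive_inner g u v w x : smooth_mx g ->
  'D_u (fun y => inner g y v w) x = inner ('D_u g) x v w.
Proof.
move=> sg.
have s1 : smooth_mx (fun y => v *m g y).
  by apply: smooth_mxM => //; exact: smooth_mx_cst.
have <- := @derive_mxE _ _ _ _ (fun y => v *m g y *m w^T) x u 0 0; last first.
  by apply: smooth_mxM => //; exact: smooth_mx_cst.
rewrite (derive_mulmx (B := fun=> w^T)) //; last exact: smooth_mx_cst.
rewrite (derive_mulmx (A := fun=> v)) //; last exact: smooth_mx_cst.
by rewrite !derive_cst mul0mx mulmx0 add0r addr0.
Qed.

Fact dinner_key : unit. Proof. exact: tt. Qed.

(* Locked: unification would otherwise compare directional derivatives along
   different vectors by unfolding limits. *)
Definition dinner g : V -> V -> V -> V -> R :=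
  locked_with dinner_key (fun x u v w => 'D_u (fun y => inner g y v w) x).

Lemma dinnerE g x u v w : dinner g x u v w = 'D_u (fun y => inner g y v w) x.
Proof. by rewrite /dinner unlock. Qed.

(* Koszul formula for the inner product of [nabla_u v] with [w]. *)
Definition lowered g x u v w : R :=
  2^-1 * (dinner g x u v w + dinner g x v u w - dinner g x w u v).

(* Vectors are rows: [nabla_v w = w *m connection g x v] for a constant field [w]. *)
Definition connection g x v : 'M[R]_d :=
  \sum_i v 0 i *: \matrix_(j, k) christoffel g i j k x.


Section Metric.
Variable g : V -> 'M[R]_d.
Hypothesis mg : riemannian_metric g.

Let smg : smooth_mx g. Proof. by case: mg. Qed.

Lemma metric_sym x : (g x)^T = g x. Proof. by case: mg. Qed.

Lemma metric_pos x u : u != 0 -> 0 < inner g x u u. Proof. by case: mg => _ _; apply. Qed.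

Lemma metric_ge0 x u : 0 <= inner g x u u.
Proof.
by have [->|u0] := eqVneq u 0; [rewrite inner0l | exact/ltW/metric_pos].
Qed.

Lemma metric_eq0 x u : inner g x u u = 0 -> u = 0.
Proof. by apply: contra_eq => /(metric_pos x)/lt0r_neq0. Qed.

Lemma metric_inj x u v : (forall w, inner g x u w = inner g x v w) -> u = v.
Proof.
move=> H; apply/subr0_eq/(@metric_eq0 x).
by rewrite innerDl innerNl H subrr.
Qed.

Lemma metric_unit x : g x \in unitmx.
Proof.
rewrite -row_free_unit; apply/row_freeP.
have : kermx (g x) = 0.
  apply/row_matrixP => i; rewrite row0; apply: (@metric_eq0 x).
  by rewrite !innerE -row_mul mulmx_ker row0 mul0mx mxE.
by move/eqP; rewrite kermx_eq0 => /row_freeP.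
Qed.

Lemma dinner_linear1 x v w : linear_form (fun u => dinner g x u v w).
Proof.
by split=> [a b|c a]; rewrite !dinnerE ?smooth_deriveD ?smooth_deriveZ //;
  exact: smooth_inner.
Qed.

Lemma dinner_linear2 x u w : linear_form (fun v => dinner g x u v w).
Proof.
split=> [a b|c a]; rewrite !dinnerE.
  rewrite -deriveD; [|exact/smooth_derivable/smooth_inner..].
  by under eq_fun do rewrite innerDl.
rewrite -[RHS]deriveZ; last exact/smooth_derivable/smooth_inner.
by under eq_fun do rewrite innerZl.
Qed.

Lemma dinnerC x w u v : dinner g x w u v = dinner g x w v u.
Proof.
rewrite !dinnerE; under eq_fun do rewrite innerC ?metric_sym //.
by [].
Qed.

Lemma dinner_linear3 x u v : linear_form (fun w => dinner g x u v w).
Proof. by have := dinner_linear2 x u v; under eq_fun do rewrite dinnerC. Qed.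

Lemma lowered_linear1 x v w : linear_form (fun u => lowered g x u v w).
Proof.
apply: linear_formZ; apply: linear_formD; last first.
  by apply: linear_formN; exact: dinner_linear2.
by apply: linear_formD; [exact: dinner_linear1 | exact: dinner_linear2].
Qed.

Lemma lowered_linear2 x u w : linear_form (fun v => lowered g x u v w).
Proof.
apply: linear_formZ; apply: linear_formD; last first.
  by apply: linear_formN; exact: dinner_linear3.
by apply: linear_formD; [exact: dinner_linear2 | exact: dinner_linear1].
Qed.

Lemma lowered_linear3 x u v : linear_form (fun w => lowered g x u v w).
Proof.
apply: linear_formZ; apply: linear_formD; last first.
  by apply: linear_formN; exact: dinner_linear1.
by apply: linear_formD; exact: dinner_linear3.
Qed.

Lemma connectionD x u v : connection g x (u + v) = connection g x u + connection g x v.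
Proof.
by rewrite /connection -big_split; apply: eq_bigr => i _; rewrite mxE scalerDl.
Qed.

Lemma connectionZ x a v : connection g x (a *: v) = a *: connection g x v.
Proof.
by rewrite /connection scaler_sumr; apply: eq_bigr => i _; rewrite mxE scalerA.
Qed.

Lemma connection_delta x i :
  connection g x (evec R i) = \matrix_(j, k) christoffel g i j k x.
Proof.
rewrite /connection (bigD1 i) //= !mxE !eqxx scale1r big1 ?addr0 // => j ji.
by rewrite mxE (negbTE ji) andbF scale0r.
Qed.

Lemma eq_linear_form f1 f2 v : linear_form f1 -> linear_form f2 ->
  (forall i, f1 (evec R i) = f2 (evec R i)) -> f1 v = f2 v :> R.
Proof.
move=> l1 l2 H; rewrite (linear_form_coord _ l1) (linear_form_coord _ l2).
by apply: eq_bigr => i _; rewrite H.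
Qed.

Lemma dinner_delta x i j l :
  dinner g x (evec R i) (evec R j) (evec R l) = partial i (fun y => g y j l) x.
Proof. by rewrite dinnerE partialE; under eq_fun do rewrite inner_delta. Qed.

Lemma lowered_delta x i j l :
  lowered g x (evec R i) (evec R j) (evec R l) = 2^-1 *
  (partial i (fun y => g y j l) x + partial j (fun y => g y i l) x
   - partial l (fun y => g y i j) x).
Proof.
by rewrite -!dinner_delta.
Qed.

(** Both sides are trilinear, so coordinate vectors suffice; there the inverse matrix inside
    [christoffel] cancels against [g]. From here on only the Koszul expression is used. *)
Lemma inner_connection x u v w :
  inner g x (v *m connection g x u) w = lowered g x u v w.
Proof.
apply: (eq_linear_form (f1 := fun u => inner g x (v *m connection g x u) w)
                       (f2 := fun u => lowered g x u v w)).
- split=> [a b|a b]; first by rewrite connectionD mulmxDr innerDl.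
  by rewrite connectionZ -scalemxAr innerZl.
- exact: lowered_linear1.
move=> i.
apply: (eq_linear_form (f1 := fun v => inner g x (v *m connection g x _) w)
                       (f2 := fun v => lowered g x _ v w)).
- exact: (linear_form_mulmx _ (inner_linear_l _ _ _)).
- exact: lowered_linear2.
move=> j.
apply: (eq_linear_form (f1 := fun w => inner g x _ w)
                       (f2 := fun w => lowered g x _ _ w)).
- exact: inner_linear_r.
- exact: lowered_linear3.
move=> l.
rewrite connection_delta lowered_delta.
rewrite innerE /evec -rowE trmx_delta -colE !mxE.
under eq_bigr do rewrite !mxE /christoffel.
under eq_bigr do rewrite -mulrA mulr_suml.
rewrite -mulr_sumr; congr (_ * _); rewrite exchange_big /=.
pose S k := partial i (fun y => g y j k) x + partial j (fun y => g y i k) x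
  - partial k (fun y => g y i j) x.
transitivity (\sum_k S k * (k == l)%:R); last first.
  rewrite (bigD1 l) //= eqxx mulr1 big1 ?addr0 // => k kl.
  by rewrite (negbTE kl) mulr0.
apply: eq_bigr => k _.
under eq_bigr do rewrite mulrAC mulrC.
rewrite -mulr_sumr; congr (_ * _).
have : (invmx (g x))^T *m g x = 1%:M.
  by rewrite -[g x in X in X *m _]metric_sym -trmx_inv trmxK mulVmx // metric_unit.
by move/matrixP/(_ k l); rewrite !mxE => <-; apply: eq_bigr => m _; rewrite mxE.
Qed.

Lemma connection_torsion_free x u v :
  u *m connection g x v = v *m connection g x u.
Proof.
apply: (@metric_inj x) => w; rewrite !inner_connection /lowered.
by rewrite [dinner g x w u v]dinnerC (addrC (dinner g x u v w)).
Qed.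

(** Metric compatibility: in the sum of the two Koszul expressions with the last arguments
    exchanged, everything cancels except the derivative along [v]. *)
Lemma derive_metric x v :
  'D_v g x = connection g x v *m g x + g x *m (connection g x v)^T.
Proof.
apply: eq_mx_rows => u; apply/trmx_inj/eq_mx_rows => w.
apply/trmx_inj; rewrite !trmx_mul !trmxK.
apply/rowP => i; rewrite ord1 {i}.
transitivity (dinner g x v u w); first by rewrite dinnerE derive_inner.
transitivity (lowered g x v u w + lowered g x v w u).
  by rewrite /lowered (dinnerC x v w u); field.
rewrite -!inner_connection (innerC (w *m _)) ?metric_sym // !innerE.
by rewrite mulmxDr mulmxDl [RHS]mxE trmx_mul !mulmxA.
Qed.

Lemma smooth_connection v : smooth_mx (fun x => connection g x v).
Proof.
apply: smooth_mx_sum => i; apply: smooth_mxZ => j k.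
under eq_fun do rewrite mxE.
apply: smoothM; first exact: smooth_cst.
apply: smooth_sum => l; apply: smoothM.
  by apply: smooth_invmx => // x; exact: metric_unit.
by apply: smoothD; [apply: smoothD|apply: smoothN]; exact: smooth_partial.
Qed.

(** The curvature components, read as a matrix identity and extended by bilinearity from coordinate
    fields to all constant fields. The action on rows reverses the order in both products. *)
Lemma flat_connection x u v : flat g ->
  'D_u (fun y => connection g y v) x - 'D_v (fun y => connection g y u) x
  + connection g x v *m connection g x u - connection g x u *m connection g x v = 0.
Proof.
move=> fg; apply/matrixP => k l; rewrite [RHS]mxE.
have sD1 w : linear_form (fun u => 'D_u (fun y => connection g y w) x k l).
  split=> [a b|c a]; first by rewrite derive_mxD ?mxE //; exact: smooth_connection.
  by rewrite derive_mxZ ?mxE //; exact: smooth_connection.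
have sD2 w : linear_form (fun u => 'D_w (fun y => connection g y u) x k l).
  split=> [a b|c a].
    under eq_fun do rewrite connectionD.
    by rewrite deriveD ?mxE //; apply: smooth_mx_derivable; exact: smooth_connection.
  under eq_fun do rewrite connectionZ.
  by rewrite deriveZ ?mxE //; apply: smooth_mx_derivable; exact: smooth_connection.
have sM1 w : linear_form (fun u => (connection g x u *m connection g x w) k l).
  split=> [a b|c a]; first by rewrite connectionD mulmxDl mxE.
  by rewrite connectionZ -scalemxAl mxE.
have sM2 w : linear_form (fun u => (connection g x w *m connection g x u) k l).
  split=> [a b|c a]; first by rewrite connectionD mulmxDr mxE.
  by rewrite connectionZ -scalemxAr mxE.
pose F u v : R := 'D_u (fun y => connection g y v) x k l
  - 'D_v (fun y => connection g y u) x k l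
  + (connection g x v *m connection g x u) k l
  - (connection g x u *m connection g x v) k l.
have L1 w : linear_form (fun u => F u w).
  apply: linear_formD; last exact: linear_formN.
  by apply: linear_formD => //; apply: linear_formD => //; exact: linear_formN.
have L2 w : linear_form (fun v => F w v).
  apply: linear_formD; last exact: linear_formN.
  by apply: linear_formD => //; apply: linear_formD => //; exact: linear_formN.
suff : F u v = 0 by move=> <-; rewrite /F !mxE.
apply: (linear_form0 _ (L1 v)) => i; apply: (linear_form0 _ (L2 _)) => j.
have DE a b : 'D_(evec R a) (fun y => connection g y (evec R b)) x k l
    = partial a (christoffel g b k l) x.
  rewrite derive_mxE; last exact: smooth_connection.
  rewrite /partial; have -> // : (fun y => connection g y (evec R b) k l) =
    christoffel g b k l.
  by apply/funext => y; rewrite connection_delta mxE.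
have ME a b : (connection g x (evec R b) *m connection g x (evec R a)) k l
    = \sum_p christoffel g b k p x * christoffel g a p l x.
  by rewrite mxE !connection_delta; apply: eq_bigr => p _; rewrite !mxE.
by rewrite -[RHS](fg i j k l x) /F /curvature !DE !ME sumrB addrA.
Qed.

End Metric.
End LeviCivita.

(** * Flat Kahler metrics *)

Section FlatKahler.
Variables (R : realType) (N : nat).
Local Notation V := 'rV[R]_(N + N).
Local Notation J := (Jmx R N).
Implicit Types (u v w x : V).

Lemma JmxK : J *m J = - 1%:M.
Proof.
rewrite /Jmx mulmx_block !mul0mx !mulmx0 mul1mx mulmx1 !add0r addr0.
by rewrite [in RHS]scalar_mx_block opp_block_mx !oppr0.
Qed.

Lemma trmx_Jmx : J^T = - J.
Proof.
by rewrite /Jmx tr_block_mx !trmx0 linearN /= trmx1 opp_block_mx !oppr0 opprK.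
Qed.

Lemma mulmxJJ u : u *m J *m J = - u.
Proof. by rewrite -mulmxA JmxK mulmxN mulmx1. Qed.

Variable g : V -> 'M[R]_(N + N).
Hypothesis kg : kahler_metric g.

Let mg : riemannian_metric g. Proof. by case: kg. Qed.
Let smg : smooth_mx g. Proof. by case: mg. Qed.
Let gJ x u v : inner g x (u *m J) (v *m J) = inner g x u v. Proof. by case: kg. Qed.
Local Notation "'Con'" := (connection g).

Lemma inner_Jl x u v : inner g x (u *m J) v = - inner g x u (v *m J).
Proof. by rewrite -(gJ x _ v) mulmxJJ innerNl. Qed.

Lemma dinner_Jl x w u v : dinner g x w (u *m J) v = - dinner g x w u (v *m J).
Proof.
rewrite !dinnerE -deriveN; last by apply/smooth_derivable/smooth_inner.
by under eq_fun do rewrite inner_Jl.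
Qed.

Lemma kahler_closed x u v w :
  dinner g x u (v *m J) w + dinner g x v (w *m J) u + dinner g x w (u *m J) v = 0.
Proof.
pose F u v w :=
  dinner g x u (v *m J) w + dinner g x v (w *m J) u + dinner g x w (u *m J) v.
have L1 v' w' : linear_form (fun u => F u v' w').
  apply: linear_formD; first apply: linear_formD.
  - exact: dinner_linear1.
  - exact: dinner_linear3.
  - exact: (linear_form_mulmx _ (dinner_linear2 mg _ _ _)).
(* Cyclic symmetry carries linearity in the first slot over to the other two. *)
have FC u' v' w' : F u' v' w' = F v' w' u' by rewrite /F -addrA addrC.
have L2 u' w' : linear_form (fun v => F u' v w').
  have := L1 w' u'.
  by have -> : (fun u => F u w' u') = (fun v => F u' v w') by apply/funext => v'; rewrite -FC.
have L3 u' v' : linear_form (fun w => F u' v' w).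
  have := L1 u' v'.
  by have -> : (fun u => F u u' v') = (fun w => F u' v' w) by apply/funext => w'; rewrite FC.
apply: (linear_form0 _ (L1 v w)) => i; apply: (linear_form0 _ (L2 _ w)) => j.
apply: (linear_form0 _ (L3 _ _)) => k; rewrite /F !dinnerE -!partialE.
by case: kg => _ _ /(_ i j k x).
Qed.

(** This says that J is parallel. Closedness at [(w, u, v)] minus closedness at
    [(w *m J, u, v *m J)] is, once J is moved across the metric, twice the claim. *)
Lemma lowered_J x u v w : lowered g x u (v *m J) w = - lowered g x u v (w *m J).
Proof.
have := kahler_closed x w u v; have := kahler_closed x (w *m J) u (v *m J).
have NN z a b : dinner g x z a (- b) = - dinner g x z a b.
  by rewrite -scaleN1r (proj2 (dinner_linear3 mg _ _ _)) mulN1r.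
rewrite !mulmxJJ (dinner_Jl x (w *m J) u) mulmxJJ (dinner_Jl x u v w) !NN.
rewrite (dinnerC mg x u (- v)) NN (dinnerC mg x u (w *m J)) (dinner_Jl x w u v).
rewrite (dinnerC mg x (v *m J) (- w)) NN.
rewrite (dinnerC mg x v (w *m J)) /lowered (dinner_Jl x u v w).
lra.
Qed.

Lemma connectionJ x v : Con x v *m J = J *m Con x v.
Proof.
apply: eq_mx_rows => u; apply: (metric_inj (x := x) mg) => w.
rewrite !mulmxA inner_Jl !(inner_connection mg) lowered_J.
by [].
Qed.

(** Torsion-freeness exchanges the differentiated vector with the direction, so commuting with J
    becomes complex linearity in the direction. *)
Lemma connection_mulJ x v : Con x (v *m J) = Con x v *m J.
Proof.
apply: eq_mx_rows => u.
rewrite (connection_torsion_free mg) -mulmxA -connectionJ mulmxA.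
by rewrite (connection_torsion_free mg) mulmxA.
Qed.

Hypothesis fg : flat g.

(** In the curvature of the pair [(v *m J, v)] the quadratic terms cancel, because [Con x (v *m J)]
    is [Con x v *m J] and commutes with [Con x v]. What is left says that differentiating [Con]
    along [v *m J] is differentiating along [v] and multiplying by J; a second J gives the minus
    sign. *)
Lemma flat_kahler_harmonic x v :
  'D_v (fun y => Con y v) x + 'D_(v *m J) (fun y => Con y (v *m J)) x = 0.
Proof.
have dJ w : 'D_w (fun y => Con y (v *m J)) x = 'D_w (fun y => Con y v) x *m J.
  have -> : (fun y => Con y (v *m J)) = (fun y => Con y v *m J).
    by apply/funext => y; exact: connection_mulJ.
  rewrite (derive_mulmx (B := fun=> J)); last exact: smooth_mx_cst.
    by rewrite derive_cst mulmx0 addr0.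
  exact: smooth_connection.
have := flat_connection mg x (v *m J) v fg.
rewrite dJ connection_mulJ -mulmxA -connectionJ mulmxA addrK => /subr0_eq E.
by rewrite dJ E -mulmxA JmxK mulmxN mulmx1 subrr.
Qed.

Lemma connection_sqr x v :
  Con x v *m Con x v + Con x (v *m J) *m Con x (v *m J) = 0.
Proof.
rewrite connection_mulJ -mulmxA (mulmxA J) -connectionJ -!mulmxA JmxK.
by rewrite !mulmxN mulmx1 subrr.
Qed.

End FlatKahler.

(** * The Bochner formula, for an abstract [S] covering both the metric and its dual *)

Section Bochner.
Variables (R : realType) (d : nat).
Local Notation V := 'rV[R]_d.
Variables (S : V -> 'M[R]_d) (A B : V -> 'M[R]_d) (v w : V).
Hypotheses (sS : smooth_mx S) (symS : forall x, (S x)^T = S x).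
Hypotheses (sA : smooth_mx A) (sB : smooth_mx B).
Hypothesis dSv : forall x, 'D_v S x = A x *m S x + S x *m (A x)^T.
Hypothesis dSw : forall x, 'D_w S x = B x *m S x + S x *m (B x)^T.
Hypothesis dAB : forall x, 'D_v A x + 'D_w B x = 0.
Hypothesis AABB : forall x, A x *m A x + B x *m B x = 0.

Let Dinner a (C : V -> 'M[R]_d) : smooth_mx C ->
  (forall x, 'D_a S x = C x *m S x + S x *m (C x)^T) ->
  forall x e, 'D_a (fun y => inner S y e e) x = 2 * inner S x (e *m C x) e.
Proof.
move=> sC dC x e; rewrite derive_inner // !innerE dC mulmxDr mulmxDl mxE.
rewrite mulmxA -innerE.
have -> : e *m (S x *m (C x)^T) *m e^T = e *m S x *m (e *m C x)^T.
  by rewrite trmx_mul !mulmxA.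
by rewrite -innerE (innerC _ e) // mulr2n mulrDl mul1r.
Qed.

(** Differentiating [C *m S] gives three terms; the one with the transposed [C] is a squared length,
    and the other two are those that the hypotheses on [A] and [B] cancel in the sum. *)
Let DDinner a (C : V -> 'M[R]_d) : smooth_mx C ->
  (forall x, 'D_a S x = C x *m S x + S x *m (C x)^T) ->
  forall x e, 'D_a ('D_a (fun y => inner S y e e)) x =
    2 * (inner S x (e *m ('D_a C x + C x *m C x)) e + inner S x (e *m C x) (e *m C x)).
Proof.
move=> sC dC x e.
rewrite (_ : 'D_a (fun y => inner S y e e) =
   fun y => 2 * (e *m (C y *m S y) *m e^T) 0 0); last first.
  by apply/funext => y; rewrite (Dinner sC) // !innerE !mulmxA.
have sCS : smooth_mx (fun y => C y *m S y) by exact: smooth_mxM.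
have -> : (fun y => 2 * (e *m (C y *m S y) *m e^T) 0 0) =
   2 \*: (fun y => inner (fun y => C y *m S y) y e e) by apply/funext.
rewrite deriveZ; last by apply/smooth_derivable/smooth_inner.
congr (_ * _); rewrite derive_inner // !innerE derive_mulmx // dC.
have addE (P Q : 'M[R]_1) : P 0 0 + Q 0 0 = (P + Q) 0 0 by rewrite mxE.
by rewrite addE trmx_mul !(mulmxDr, mulmxDl) !mulmxA addrA.
Qed.

(* Bochner formula: the second-order terms cancel, leaving squared lengths. *)
Lemma bochner x e :
  'D_v ('D_v (fun y => inner S y e e)) x + 'D_w ('D_w (fun y => inner S y e e)) x
  = 2 * (inner S x (e *m A x) (e *m A x) + inner S x (e *m B x) (e *m B x)).
Proof.
rewrite (DDinner sA) // (DDinner sB) // -mulrDr addrACA; congr (_ * _).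
by rewrite -innerDl -mulmxDr addrACA dAB AABB addr0 mulmx0 inner0l add0r.
Qed.

End Bochner.

(** * Liouville's theorem for subharmonic functions *)

Section Liouville.
Variable R : realType.

Lemma is_derive_continuous (f : R -> R) (x l : R) :
  is_derive x 1 f l -> {for x, continuous f}.
Proof.
by case=> /derivable1_diffP/differentiable_continuous.
Qed.

(** If [l] were positive, [h'], which vanishes at the maximum [a], would be positive just to its
    right, and the mean value theorem would produce a larger value of [h]. Only differentiability of
    [h'] at the single point [a] enters. *)
Lemma second_derivative_at_max (h h' : R -> R) (a l : R) :
  (\forall t \near a, is_derive (t : R) (1 : R) h (h' t) /\ h t <= h a) ->
  is_derive a 1 h' l -> l <= 0.
Proof.
move=> /nbhs_ballP[r /= r0 B] dh'.
have Hr t : a - r < t < a + r -> is_derive t 1 h (h' t) /\ h t <= h a.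
  by move=> tr; apply: B; rewrite -ball_normE /= ltr_distlC.
have h'a : h' a = 0.
  have aa : a - r < a < a + r by rewrite gtrBl ltrDl r0.
  have [_ <-] := proj1 (Hr a aa).
  have H := @derive1_at_max R h (a - r) (a + r) a.
  apply: (@derive_val _ _ _ _ _ _ _ (H _ _ _ _)).
  - by move: r0; lra.
  - by move=> t; rewrite in_itv /= => /Hr[[]].
  - by rewrite in_itv.
  - by move=> t; rewrite in_itv /= => /Hr[].
rewrite leNgt; apply/negP => l0.
have [d d0 Hd] : exists2 d, 0 < d & forall t, 0 < t < d -> 0 < h' (a + t).
  have [dh dl] := dh'.
  have : (fun t => t^-1 *: ((h' \o shift a) (t *: 1) - h' a)) @ 0^' --> l.
    by rewrite -dl; exact: dh.
  move/cvgr_gt => /(_ _ l0) /nbhs_ballP[d /= d0 Bd]; exists d => // t /andP[t0 td].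
  have := Bd t; rewrite -ball_normE /= sub0r normrN gtr0_norm // => /(_ td).
  rewrite h'a subr0 [t *: 1]mulr1 addrC gt_eqF // => /(_ isT).
  by rewrite [_ *: _]/(_ * _) pmulr_rgt0 // invr_gt0.
pose e := Num.min d r / 2.
have m0 : 0 < Num.min d r by rewrite lt_min d0 r0.
have e0 : 0 < e by rewrite divr_gt0.
have /andP[ed er] : (e < d) && (e < r).
  by rewrite -lt_min /e ltr_pdivrMr // ltr_pMr // ltr1n.
have De t : a <= t <= a + e -> is_derive t 1 h (h' t).
  move=> /andP[t1 t2]; apply: (proj1 (Hr _ _)).
  by rewrite (lt_le_trans _ t1) ?(le_lt_trans t2) ?ltrD2l // gtrBl.
have [] := @MVT R h h' a (a + e).
- by rewrite ltrDl.
- by move=> t; rewrite in_itv /= => /andP[t1 t2]; apply: De; rewrite !ltW.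
- apply: derivable_within_continuous => t; rewrite in_itv /= => tae.
  by case: (De t tae).
move=> c cae E.
have : h (a + e) - h a <= 0.
  rewrite subr_le0; apply: (proj2 (Hr _ _)).
  by apply/andP; split; lra.
rewrite E addrC addKr leNgt => /negP; apply; rewrite mulr_gt0 //.
move: cae; rewrite in_itv /= => /andP[c1 c2].
have -> : c = a + (c - a) by rewrite addrC subrK.
by apply: Hd; rewrite subr_gt0 c1 /= (lt_trans _ ed) // ltrBlDl.
Qed.

(* A radial function of [S = s^2 + c^2], strictly superharmonic in the plane and
   tending to infinity with [S]. *)
Definition barrier (S : R) : R := ln S - S^-1.

(** [barrier1] and [barrier2] are the first and second derivatives in [s] of
    [barrier (s ^+ 2 + c ^+ 2)]. *)
Definition barrier1 (c s : R) : R :=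
  2 * s / (s ^+ 2 + c ^+ 2) + 2 * s / (s ^+ 2 + c ^+ 2) ^+ 2.

Definition barrier2 (c s : R) : R :=
  let S := s ^+ 2 + c ^+ 2 in
  2 / S + 2 / S ^+ 2 - 4 * s ^+ 2 / S ^+ 2 - 8 * s ^+ 2 / S ^+ 3.

Lemma is_derive_sqrD (c s : R) : is_derive s 1 (fun t => t ^+ 2 + c ^+ 2) (2 * s).
Proof.
have := @is_deriveD R R R (fun t => t ^+ 2) (cst (c ^+ 2)) s 1 _ _
  (is_deriveX 2 (is_derive_id s 1)) (is_derive_cst _ _ _).
by move/is_derive_eq; apply; rewrite addr0 expr1 [_ *: 1]mulr1.
Qed.

Lemma is_derive_inv (f : R -> R) (s l : R) : f s != 0 -> is_derive s 1 f l ->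
  is_derive s 1 (fun t => (f t)^-1) (- l / f s ^+ 2).
Proof.
move=> f0 [df <-]; split; first exact: derivableV.
by rewrite deriveV // [_ *: _]mulrC mulrN mulNr.
Qed.

Lemma is_derive_barrier (c s : R) : 0 < s ^+ 2 + c ^+ 2 ->
  is_derive s 1 (fun t => barrier (t ^+ 2 + c ^+ 2)) (barrier1 c s).
Proof.
move=> S0.
have dS := is_derive_sqrD c s.
have d1 := @is_derive1_comp R (@ln R) (fun t => t ^+ 2 + c ^+ 2) s _ _ (is_derive1_ln S0) dS.
have d2 := @is_derive_inv (fun t => t ^+ 2 + c ^+ 2) s _ (lt0r_neq0 S0) dS.
apply: (is_derive_eq (is_deriveB d1 d2)).
by rewrite /barrier1 mulNr opprK [_^-1 * _]mulrC.
Qed.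

Lemma is_derive_barrier1 (c s : R) : 0 < s ^+ 2 + c ^+ 2 ->
  is_derive s 1 (barrier1 c) (barrier2 c s).
Proof.
move=> S0; have S0' := lt0r_neq0 S0.
have dS := is_derive_sqrD c s.
have d1 := @is_derive_inv (fun t => t ^+ 2 + c ^+ 2) s _ S0' dS.
have d2 := @is_deriveX R R (fun t => (t ^+ 2 + c ^+ 2)^-1) 2 s 1 _ d1.
have d3 : is_derive s 1 (fun t : R => 2 * t) 2.
  by apply: (is_derive_eq (is_deriveZ 2 (is_derive_id s 1))); rewrite [_ *: 1]mulr1.
have d4 := is_deriveM d3 (is_deriveD d1 d2).
have E : barrier1 c = (fun t => 2 * t) * ((fun t => (t ^+ 2 + c ^+ 2)^-1) +
    (fun t => (t ^+ 2 + c ^+ 2)^-1) ^+ 2).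
  by apply/funext => t; rewrite /barrier1 -mulrDr -exprVn.
pose S := s ^+ 2 + c ^+ 2.
have d5 : is_derive s 1 (barrier1 c)
  (2 * s * (- (2 * s) / S ^+ 2 + 2 * S^-1 * (- (2 * s) / S ^+ 2))
   + (S^-1 + S^-1 ^+ 2) * 2) by rewrite E.
by apply: (is_derive_eq d5); rewrite /barrier2 -/S; field.
Qed.

(** [ln S] is harmonic in the punctured plane; the term [- S^-1] was added to make the Laplacian
    strictly negative, as the second-derivative test needs. *)
Lemma barrier_laplacian (s t : R) : 0 < s ^+ 2 + t ^+ 2 ->
  barrier2 t s + barrier2 s t = - 4 / (s ^+ 2 + t ^+ 2) ^+ 2.
Proof.
move=> S0; rewrite /barrier2 [t ^+ 2 + s ^+ 2]addrC.
have -> : s ^+ 2 = (s ^+ 2 + t ^+ 2) - t ^+ 2 by rewrite addrK.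
rewrite subrK; set S := _ + t ^+ 2 in S0 *.
by field; exact: lt0r_neq0.
Qed.

Lemma barrier_unbounded (M : R) : exists2 S0 : R, 1 <= S0 & forall S, S0 <= S -> M <= barrier S.
Proof.
(* Beyond this value [ln S] is at least [M + 1], while [S^-1] costs at most 1. *)
exists (Num.max 1 (expR (M + 1))); first by rewrite le_max lexx.
move=> S; rewrite ge_max => /andP[S1 SM].
have S0 : 0 < S by exact: lt_le_trans S1.
rewrite /barrier lerBrDr (@le_trans _ _ (M + 1)) ?lerD2l ?invf_le1 //.
by rewrite -[leLHS]expRK ler_ln ?posrE ?expR_gt0.
Qed.

End Liouville.

Section Subharmonic.
Variables (R : realType) (d : nat) (f : 'rV[R]_d -> R) (v w : 'rV[R]_d).
Hypothesis sf : smooth f.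
Hypothesis lapf : forall y, 0 <= 'D_v ('D_v f) y + 'D_w ('D_w f) y.

Let cvg_sqr (T : Type) (F : set_system T) (FF : Filter F) (h : T -> R) (l : R) :
  h x @[x --> F] --> l -> (h x ^+ 2) @[x --> F] --> l ^+ 2.
Proof. by move=> hl; exact: (cvgM hl hl). Qed.

Let S (p : R * R) : R := p.1 ^+ 2 + p.2 ^+ 2.

Let continuous_S : continuous S.
Proof.
move=> p; apply: cvgD; first by apply: cvg_sqr; exact: cvg_fst.
by apply: cvg_sqr; exact: cvg_snd.
Qed.

Let compact_annulus (a b : R) : compact [set p | a <= S p <= b].
Proof.
have cbox : compact (`[- (1 + `|b|), 1 + `|b|] `*` `[- (1 + `|b|), 1 + `|b|] : set (R * R)).
  by apply: compact_setX; exact: segment_compact.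
apply: (subclosed_compact _ cbox) => [|[s t] /=].
  rewrite (_ : mkset _ = S @^-1` `[a, b]%classic).
    by apply: closed_comp; [move=> p _; exact: continuous_S | exact: itv_closed].
  by apply/seteqP; split => p /=; rewrite in_itv.
rewrite /S /= => /andP[_ Sb].
have H (z : R) : z ^+ 2 <= b -> z \in `[- (1 + `|b|), 1 + `|b|].
  move=> zb; rewrite in_itv /=; have bb := ler_norm b; have B0 := normr_ge0 b.
  by apply/andP; split; nra.
by split; apply: H; apply: le_trans Sb; rewrite ?lerDl ?lerDr sqr_ge0.
Qed.

Let plane x (p : R * R) := x + p.1 *: v + p.2 *: w.

Let continuous_plane x : continuous (fun p => f (plane x p)).
Proof.
move=> p; apply: continuous_comp; last exact: smooth_continuous.
apply: cvgD; last by apply: cvgZr_tmp; exact: cvg_snd.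
by apply: cvgD; [exact: cvg_cst | apply: cvgZr_tmp; exact: cvg_fst].
Qed.

(* The maximum of [f - k * barrier] on an annulus [a <= S <= b] is attained on
   the boundary. *)
Let annulus_interior x (a b k : R) (c : R * R) : 0 < a -> 0 < k -> a < S c < b ->
  (forall p, a <= S p <= b ->
     f (plane x p) - k * barrier (S p) <= f (plane x c) - k * barrier (S c)) ->
  False.
Proof.
case: c => c1 c2 a0 k0 /andP[/= aS Sb] cmax.
have S0 : 0 < c1 ^+ 2 + c2 ^+ 2 by exact: lt_trans aS.
have df u y : is_derive y u f ('D_u f y) by exact/derivableP/smooth_derivable.
have ddf u y : is_derive y u ('D_u f) ('D_u ('D_u f) y).
  exact/derivableP/smooth_derivable/smooth_derive.
have near_S (z e : R) : a < z ^+ 2 + e ^+ 2 -> z ^+ 2 + e ^+ 2 < b ->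
    \forall t \near z, a < t ^+ 2 + e ^+ 2 /\ t ^+ 2 + e ^+ 2 < b.
  move=> H1 H2; have cS : (t ^+ 2 + e ^+ 2) @[t --> z] --> z ^+ 2 + e ^+ 2.
    by apply: cvgD; [apply: cvg_sqr; exact: cvg_id | exact: cvg_cst].
  near=> t; split; near: t; [exact: (cvgr_gt _ cS)|exact: (cvgr_lt _ cS)].
have H1 : 'D_v ('D_v f) (plane x (c1, c2)) - k * barrier2 c2 c1 <= 0.
  apply: (@second_derivative_at_max R
    (fun t => f (plane x (t, c2)) - k * barrier (t ^+ 2 + c2 ^+ 2))
    (fun t => 'D_v f (plane x (t, c2)) - k * barrier1 c2 t) c1).
    have := near_S c1 c2 aS Sb; apply: filterS => t [t1 t2]; split; last first.
      by apply: (cmax (t, c2)); rewrite /S /= !ltW.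
    apply: is_deriveB; last first.
      apply: (is_deriveZ k); apply: is_derive_barrier; exact: lt_trans t1.
    rewrite /plane /=; under eq_fun do rewrite addrAC.
    rewrite addrAC; exact: is_derive_line.
  apply: is_deriveB; last by apply: (is_deriveZ k); exact: is_derive_barrier1.
  rewrite /plane /=; under eq_fun do rewrite addrAC.
  rewrite addrAC; exact: is_derive_line.
have H2 : 'D_w ('D_w f) (plane x (c1, c2)) - k * barrier2 c1 c2 <= 0.
  apply: (@second_derivative_at_max R
    (fun t => f (plane x (c1, t)) - k * barrier (t ^+ 2 + c1 ^+ 2))
    (fun t => 'D_w f (plane x (c1, t)) - k * barrier1 c1 t) c2).
    have := near_S c2 c1; rewrite addrC => /(_ aS Sb).
    apply: filterS => t [t1 t2]; split; last first.
      have := cmax (c1, t); rewrite /S /= [c1 ^+ 2 + t ^+ 2]addrC.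
      by rewrite [c1 ^+ 2 + c2 ^+ 2]addrC; apply; rewrite !ltW.
    apply: is_deriveB; last first.
      apply: (is_deriveZ k); apply: is_derive_barrier; exact: lt_trans t1.
    rewrite /plane /=; exact: is_derive_line.
  apply: is_deriveB; last first.
    by apply: (is_deriveZ k); apply: is_derive_barrier1; rewrite addrC.
  rewrite /plane /=; exact: is_derive_line.
(* The two second-derivative tests add up to: Laplacian of [f] at most [- (k * q)] with [k * q > 0],
   against subharmonicity. *)
have := barrier_laplacian S0; have := lapf (plane x (c1, c2)).
have : 0 < 4 / (c1 ^+ 2 + c2 ^+ 2) ^+ 2 by rewrite divr_gt0 // exprn_gt0.
rewrite mulNr; set q := 4 / _ => q0 lap E.
have : k * barrier2 c2 c1 + k * barrier2 c1 c2 = - (k * q) by rewrite -mulrDr E mulrN.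
have := mulr_gt0 k0 q0; move: H1 H2 lap.
move: ('D_v ('D_v f) _) ('D_w ('D_w f) _) (k * q) (k * _) (k * _) => A B C D F.
by lra.
Unshelve. all: by end_near. Qed.

(** [f - k * barrier] is maximised over an annulus containing [q]. The interior is excluded, the
    outer circle is excluded because the barrier grows while [f] stays below [M], and on the inner
    circle [f] is close to [f x]; a small [k] then transfers the bound to [q]. *)
Let subharmonic_le x (M : R) : (forall p, f (plane x p) <= M) ->
  forall p, f (plane x p) <= f x.
Proof.
move=> fM q; apply/ler_addgt0Pr => e e0.
have [Sq0|Sq0] := eqVneq (S q) 0.
  have /eqP := Sq0; rewrite /S paddr_eq0 ?sqr_ge0 // !expf_eq0 /=.
  by move=> /andP[/eqP q1 /eqP q2]; rewrite /plane q1 q2 !scale0r !addr0 lerDl ltW.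
have Sq : 0 < S q by rewrite lt_neqAle eq_sym Sq0 addr_ge0 ?sqr_ge0.
have [a a0 Ha] : exists2 a, 0 < a & forall p, S p <= a -> f (plane x p) <= f x + e / 2.
  have /cvgrPdist_lt/(_ (e / 2)) := @continuous_plane x (0, 0).
  rewrite divr_gt0 // => /(_ isT) /nbhs_ballP[r /= r0 B].
  exists (r ^+ 2 / 4); first by rewrite divr_gt0 // exprn_gt0.
  move=> [p1 p2] /= Sp.
  have Hp (z : R) : z ^+ 2 <= r ^+ 2 / 4 -> `|0 - z| < r.
    by move=> zr; rewrite sub0r normrN real_ltr_norml ?num_real //; nra.
  have := B (p1, p2); rewrite /plane /= !scale0r !addr0 => /(_ _).
  have Sp' : p1 ^+ 2 + p2 ^+ 2 <= r ^+ 2 / 4 by [].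
  have H : ball (0 : R, 0 : R) r (p1, p2).
    split; rewrite -ball_normE /=; apply: Hp; apply: le_trans Sp';
    by rewrite ?lerDl ?lerDr sqr_ge0.
  by move=> /(_ H); rewrite ltr_norml => /andP[]; lra.
(* The inner radius is lowered so that [q] lies in the annulus even when [S q < a]. *)
pose a' := Num.min a (S q).
have a'0 : 0 < a' by rewrite lt_min a0 Sq.
(* Half of [e] pays for continuity at [x], the other half for the change of the barrier from the
   inner circle to [q]. *)
pose k := e / 2 / (1 + `|barrier (S q) - barrier a'|).
have den0 : 0 < 1 + `|barrier (S q) - barrier a'| by rewrite ltr_pwDl.
have k0 : 0 < k by rewrite !divr_gt0.
have kb : k * (barrier (S q) - barrier a') <= e / 2.
  apply: (@le_trans _ _ (k * (1 + `|barrier (S q) - barrier a'|))).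
    by rewrite ler_pM2l // (le_trans (ler_norm _)) // lerDr.
  by rewrite /k divfK // gt_eqF.
(* On the outer circle the value of [f - k * barrier] is then lower by at least 1 than its value at
   [q], so the maximum cannot be there. *)
have [b1 _ Hb] := barrier_unbounded ((M - f (plane x q) + 1) / k + barrier (S q)).
pose b := Num.max b1 (S q).
have aqb : a' <= S q <= b by rewrite /a' /b ge_min le_max !lexx !orbT.
have [|||c] := @compact_EVT_max _ R (fun p => f (plane x p) - k * barrier (S p))
  [set p | a' <= S p <= b].
- by exists q.
- exact: compact_annulus.
- apply: continuous_in_subspaceT => p /set_mem /= /andP[ap _].
  have Sp0 : 0 < S p by exact: lt_le_trans ap.
  apply: cvgB; first exact: continuous_plane.
  apply: cvgM; first exact: cvg_cst.
  apply: cvgB.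
    by apply: (@continuous_comp _ _ _ S (@ln R)); [exact: continuous_S|exact: continuous_ln].
  by apply: cvgV; [exact: lt0r_neq0 | exact: continuous_S].
move=> /set_mem /= /andP[ac cb] cmax.
have cmax' p : a' <= S p <= b ->
    f (plane x p) - k * barrier (S p) <= f (plane x c) - k * barrier (S c).
  by move=> H; apply: cmax; exact: mem_set.
have cq := cmax' q aqb.
have [Sca|aSc] := leP (S c) a'.
  have E : S c = a' by apply/eqP; rewrite eq_le Sca ac.
  have : f (plane x c) <= f x + e / 2 by apply: Ha; rewrite E /a' ge_min lexx.
  by move: cq kb; rewrite E; lra.
have [bSc|Scb] := leP b (S c).
  have : (M - f (plane x q) + 1) / k + barrier (S q) <= barrier (S c).
    by apply: Hb; apply: le_trans bSc; rewrite le_max lexx.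
  rewrite -lerBrDr ler_pdivrMr //.
  by have := fM c; move: cq; rewrite mulrBl ![_ * k]mulrC; lra.
by case: (@annulus_interior x a' b k c); rewrite ?aSc.
Qed.

(** The value at any centre dominates the whole plane; taking the other point as centre reverses the
    inequality. *)
Lemma subharmonic_constant x (M : R) :
  (forall s t, f (x + s *: v + t *: w) <= M) ->
  forall s t, f (x + s *: v + t *: w) = f x.
Proof.
move=> fM s t; apply/eqP; rewrite eq_le; apply/andP; split.
  by apply: (@subharmonic_le x M _ (s, t)) => -[s' t']; exact: fM.
have E s' t' : plane (plane x (s, t)) (s', t') = plane x (s + s', t + t').
  by rewrite /plane /= !scalerDl !addrA [X in X + _](addrAC _ (t *: w)).
have := @subharmonic_le (plane x (s, t)) M _ (- s, - t).
rewrite E !subrr; have -> : plane x (0, 0) = x by rewrite /plane /= !scale0r !addr0.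
apply=> -[s' t'].
by rewrite E; exact: fM.
Qed.

End Subharmonic.

(** * Complex coordinates and the deck action *)

Section ComplexCoordinates.
Variable R : realType.
Local Notation C := R[i].
Local Notation Re := (@complex.Re R).
Local Notation Im := (@complex.Im R).

Lemma cReD (a b : C) : Re (a + b) = Re a + Re b. Proof. by case: a; case: b. Qed.
Lemma cImD (a b : C) : Im (a + b) = Im a + Im b. Proof. by case: a; case: b. Qed.
Lemma cReN (a : C) : Re (- a) = - Re a. Proof. by case: a. Qed.
Lemma cImN (a : C) : Im (- a) = - Im a. Proof. by case: a. Qed.
Lemma cReM (a b : C) : Re (a * b) = Re a * Re b - Im a * Im b.
Proof. by case: a; case: b. Qed.
Lemma cImM (a b : C) : Im (a * b) = Re a * Im b + Im a * Re b.
Proof. by case: a; case: b. Qed.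
Lemma cReJ (a : C) : Re (Num.conj a) = Re a. Proof. by case: a. Qed.
Lemma cImJ (a : C) : Im (Num.conj a) = - Im a. Proof. by case: a. Qed.
Lemma complex_eq (a b : C) : Re a = Re b -> Im a = Im b -> a = b.
Proof. by case: a b => [a1 a2] [b1 b2] /= -> ->. Qed.

Definition cnorm2 (a : C) : R := Re a ^+ 2 + Im a ^+ 2.

Lemma cnorm2M (a b : C) : cnorm2 (a * b) = cnorm2 a * cnorm2 b.
Proof. by rewrite /cnorm2 cReM cImM; ring. Qed.

Lemma cnorm2_exp (w : C) : cnorm2 (cexp w) = expR (2 * Re w).
Proof.
rewrite /cnorm2 /cexp /= !exprMn -mulrDr cos2Dsin2 mulr1.
by rewrite -expRM_natl mulr_natl.
Qed.

Lemma cnorm2_unit (a : C) : `|a| = 1 -> cnorm2 a = 1.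
Proof.
move=> a1; have := add_Re2_Im2 a; rewrite a1 expr1n.
by case.
Qed.

Lemma cexp0 : cexp (0 : C) = 1.
Proof. by rewrite /cexp /= expR0 cos0 sin0 !mul1r. Qed.

Section Coordinates.
Variable N : nat.
Local Notation V := 'rV[R]_(N + N).
Local Notation J := (Jmx R N).

Lemma to_complexK (x : V) : to_real (to_complex x) = x.
Proof.
rewrite /to_real -[RHS]hsubmxK; congr row_mx; by apply/rowP => j; rewrite !mxE.
Qed.

Lemma to_realK (z : 'rV[C]_N) : to_complex (to_real z) = z.
Proof.
apply/rowP => j; rewrite /to_real /to_complex mxE row_mxKl row_mxKr !mxE.
by case: (z 0 j).
Qed.

Lemma to_realD (z w : 'rV[C]_N) : to_real (z + w) = to_real z + to_real w.
Proof.
rewrite /to_real add_row_mx; congr row_mx; apply/rowP => j; rewrite !mxE.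
  by rewrite cReD.
by rewrite cImD.
Qed.

Lemma to_real0 : to_real (0 : 'rV[C]_N) = 0.
Proof. by apply: (addrI (to_real 0)); rewrite -to_realD !addr0. Qed.

Lemma to_complexD (x y : V) : to_complex (x + y) = to_complex x + to_complex y.
Proof. by rewrite -[RHS]to_realK to_realD !to_complexK. Qed.

Lemma to_complex0 : to_complex (0 : V) = 0.
Proof. by rewrite -[RHS]to_realK to_real0. Qed.

(** Real form, acting on rows, of the complex diagonal matrix with entries [e]. *)
Definition scale_mx (e : 'rV[C]_N) : 'M[R]_(N + N) :=
  block_mx (diag_mx (map_mx Re e)) (diag_mx (map_mx Im e))
           (- diag_mx (map_mx Im e)) (diag_mx (map_mx Re e)).

Lemma to_real_scale (e z : 'rV[C]_N) :
  to_real (\row_j (e 0 j * z 0 j)) = to_real z *m scale_mx e.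
Proof.
rewrite /to_real /scale_mx mul_row_block !mulmxN !mul_mx_diag.
congr row_mx; apply/rowP => j; rewrite !mxE.
  by rewrite cReM; ring.
by rewrite cImM; ring.
Qed.

Lemma to_complex_scale (e : 'rV[C]_N) (x : V) :
  to_complex (x *m scale_mx e) = \row_j (e 0 j * to_complex x 0 j).
Proof. by rewrite -[RHS]to_realK to_real_scale to_complexK. Qed.

Lemma scale_mx_const (a : C) :
  scale_mx (const_mx a) = Re a *: 1%:M + Im a *: J.
Proof.
rewrite /scale_mx /Jmx !map_const_mx !diag_const_mx scale_block_mx.
rewrite [X in _ = _ *: X + _]scalar_mx_block scale_block_mx add_block_mx.
by rewrite !scaler0 !addr0 !add0r scalerN !scale_scalar_mx !mulr1.
Qed.

Lemma to_realZ (a : C) (z : 'rV[C]_N) :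
  to_real (a *: z) = Re a *: to_real z + Im a *: (to_real z *m J).
Proof.
have -> : a *: z = \row_j ((const_mx a : 'rV_N) 0 j * z 0 j).
  by apply/rowP => j; rewrite !mxE.
by rewrite to_real_scale scale_mx_const mulmxDr -!scalemxAr mulmx1.
Qed.

Lemma to_complexZ (a : R) (x : V) : to_complex (a *: x) = a%:C%C *: to_complex x.
Proof. by rewrite -[RHS]to_realK to_realZ /= scale0r addr0 to_complexK. Qed.

Lemma to_complexJ (x : V) : to_complex (x *m J) = 'i%C *: to_complex x.
Proof. by rewrite -[RHS]to_realK to_realZ /= scale0r scale1r add0r to_complexK. Qed.

Lemma trmx_scale_mx (e : 'rV[C]_N) : (scale_mx e)^T = scale_mx (map_mx Num.conj e).
Proof.
rewrite /scale_mx tr_block_mx linearN /= !tr_diag_mx.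
have -> : map_mx Re (map_mx Num.conj e) = map_mx Re e.
  by apply/rowP => j; rewrite !mxE cReJ.
have -> : map_mx Im (map_mx Num.conj e) = - map_mx Im e.
  by apply/rowP => j; rewrite !mxE cImJ.
by rewrite !raddfN opprK.
Qed.

Lemma scale_mx_unit (e : 'rV[C]_N) : (forall j, e 0 j != 0) -> scale_mx e \in unitmx.
Proof.
move=> e0; have : scale_mx (map_mx GRing.inv e) *m scale_mx e = 1%:M.
  apply: eq_mx_rows => x; rewrite mulmx1 mulmxA -[RHS]to_complexK -[LHS]to_complexK.
  rewrite !to_complex_scale; congr to_real; apply/rowP => j.
  by rewrite !mxE mulrA divff ?mul1r.
by move/mulmx1_unit => [].
Qed.

End Coordinates.
End ComplexCoordinates.

(** * Smoothness of linear forms, bounds on balls, and a criterion for the differential *)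

Section Differential.
Variable R : realType.

Lemma linear_form_smooth (n : nat) (f : 'rV[R]_n -> R) : linear_form f -> smooth f.
Proof.
move=> lf; have -> : f = fun v => \sum_i v 0 i * f (evec R i).
  by apply/funext => v; exact: linear_form_coord.
apply: smooth_sum => i; apply: smoothM; last exact: smooth_cst.
have dc (x v : 'rV[R]_n) : derivable (fun y : 'rV[R]_n => y 0 i) x v.
  have did : derivable (id : 'rV[R]_n -> 'rV[R]_n) x v by exact: derivable_id.
  exact: (proj1 (derivable_mxP id x v) did 0 i).
have Dc (x v : 'rV[R]_n) : 'D_v (fun y : 'rV[R]_n => y 0 i) x = v 0 i.
  have did : derivable (id : 'rV[R]_n -> 'rV[R]_n) x v by exact: derivable_id.
  have := derive_mx did.
  by rewrite derive_id => /matrixP/(_ 0 i) ->; rewrite mxE.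
move=> r; case: r => [|r]; split => //; try exact: coord_continuous.
move=> k; split=> [x|]; first exact: dc.
have -> : partial k (fun v : 'rV[R]_n => v 0 i) = fun=> evec R k 0 i.
  by apply/funext => v; rewrite partialE Dc.
exact: Ck_cst.
Qed.

Lemma bounded_on_ball (n : nat) (f : 'rV[R]_n -> R) (K : R) : continuous f ->
  exists M, forall x, `|x| <= K -> f x <= M.
Proof.
move=> cf; have [K0|K0] := ltP K 0.
  by exists 0 => x xK; have := le_lt_trans (le_trans (normr_ge0 x) xK) K0; rewrite ltxx.
have [] := @compact_EVT_max _ R f [set x | `|x| <= K].
- by exists 0; rewrite /= normr0.
- apply: bounded_closed_compact.
    by exists K; split; [exact: num_real | move=> M KM x /= xK; exact: le_trans (ltW KM)].
  rewrite (_ : mkset _ = Num.norm @^-1` [set y | y <= K]) //.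
  by apply: closed_comp; [move=> x _; exact: norm_continuous | exact: closed_le].
- exact: continuous_subspaceT.
by move=> c _ Hc; exists (f c) => x xK; apply: Hc; exact: mem_set.
Qed.

Lemma norm_mulmx_le (m n : nat) (u : 'rV[R]_m) (A : 'M[R]_(m, n)) (c : R) :
  0 <= c -> (forall i j, `|A i j| <= c) -> `|u *m A| <= `|u| * (m%:R * c).
Proof.
move=> c0 Ac; rewrite [leLHS]/Num.Def.normr/= mx_normrE.
apply: bigmax_le => [|[i j] _]; first by rewrite !mulr_ge0.
rewrite /= mxE; apply: (le_trans (ler_norm_sum _ _ _)).
apply: (@le_trans _ _ (\sum_(k < m) `|u| * c)); last first.
  by rewrite sumr_const card_ord -[leLHS]mulr_natl mulrCA.
apply: ler_sum => k _; rewrite normrM ler_pM //.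
rewrite [leRHS]/Num.Def.normr/= mx_normrE.
exact: (@le_bigmax _ _ _ _ (fun ij : 'I_1 * 'I_m => `|u ij.1 ij.2|) (i, k)).
Qed.

Lemma mulmxr_continuous (m n : nat) (A : 'M[R]_(m, n)) :
  continuous (fun u : 'rV[R]_m => u *m A).
Proof.
pose c := \sum_i \sum_j `|A i j|.
have c0 : 0 <= c by rewrite sumr_ge0 // => i _; rewrite sumr_ge0.
have Ac i j : `|A i j| <= c.
  rewrite /c (bigD1 i) //= (bigD1 j) //= -addrA lerDl addr_ge0 ?sumr_ge0 //.
  by move=> k _; rewrite sumr_ge0.
move=> x; apply/(@cvgrPdist_lt _ _ _ (nbhs x) (nbhs_filter x)) => e e0.
have c1 : 0 < m%:R * c + 1 by rewrite ltr_wpDl // mulr_ge0.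
have H : 0 < e / (m%:R * c + 1) by rewrite divr_gt0.
have /(@cvgrPdist_lt _ _ _ (nbhs x) (nbhs_filter x))/(_ _ H) :
  y @[y --> x] --> x by exact: cvg_id.
apply: (@filterS _ _ (nbhs_filter x)) => y; rewrite ltr_pdivlMr // => Hy.
rewrite -mulmxBl (le_lt_trans (norm_mulmx_le _ c0 Ac)) //.
by apply: le_lt_trans Hy; rewrite ler_wpM2l // lerDl.
Qed.

(** An exact increment [h *m M h] with [M] continuous at 0 differs from [h *m M 0] by o(h). This
    yields the differential of a deck map without differentiating its exponential. *)
Lemma diff_of_mulmx (m n : nat) (F : 'rV[R]_m -> 'rV[R]_n) x (M : 'rV[R]_m -> 'M[R]_(m, n)) :
  (forall h, F (x + h) = F x + h *m M h) ->
  (forall i j, {for 0, continuous (fun h => M h i j)}) ->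
  forall u, 'd F x u = u *m M 0.
Proof.
move=> FM cM u.
suff -> : 'd F x = (mulmxr (M 0) : {linear 'rV[R]_m -> 'rV[R]_n}) :> (_ -> _) by [].
apply: diff_unique; first exact: mulmxr_continuous.
apply/eqaddoP => _/posnumP[e].
near=> h.
rewrite /= -[X in `|X|]/(F (h + x) - (F x + h *m M 0)).
rewrite [h + x]addrC FM opprD addrA [F x + _]addrC addrK -mulmxBr.
have m1 : 0 < m%:R + 1 :> R by rewrite ltr_wpDl.
have cc : 0 <= e%:num / (m%:R + 1) by rewrite divr_ge0 // ltW.
apply: (le_trans (norm_mulmx_le (c := e%:num / (m%:R + 1)) _ cc _)); last first.
  rewrite mulrC ler_wpM2r // mulrCA ler_piMr // ler_pdivrMr // mul1r lerDl //.
move=> i j; rewrite !mxE; move: i j; near: h.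
apply: filter_forall => i; apply: filter_forall => j.
have /cvgrPdist_le/(_ (e%:num / (m%:R + 1))) := cM i j.
rewrite divr_gt0 // => /(_ isT); apply: filterS => h.
by rewrite distrC.
Unshelve. all: by end_near. Qed.

End Differential.

(** * Reduction modulo a lattice *)

Section Lattice.
Variables (R : realType) (m : nat).
Local Notation C := R[i].

(** In real coordinates the [b i] are the rows of a square matrix, which real independence makes
    invertible. *)
Lemma lattice_span (b : 'I_(m + m) -> 'rV[C]_m) :
  (forall t : 'I_(m + m) -> R, \sum_i (t i)%:C%C *: b i = 0 -> forall i, t i = 0) ->
  forall z, exists t : 'I_(m + m) -> R, z = \sum_i (t i)%:C%C *: b i.
Proof.
move=> free z; pose B : 'M[R]_(m + m) := \matrix_i to_real (b i).
have rB (t : 'rV[R]_(m + m)) : t *m B = to_real (\sum_i (t 0 i)%:C%C *: b i).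
  rewrite mulmx_sum_row.
  elim/big_rec2 : _ => [|i y x _ ->]; first by rewrite to_real0.
  by rewrite to_realD to_realZ /= scale0r addr0 rowK.
have uB : B \in unitmx.
  rewrite -row_free_unit -kermx_eq0; apply/eqP/row_matrixP => i; rewrite row0.
  have := rB (row i (kermx B)); rewrite -row_mul mulmx_ker row0 => E.
  apply/rowP => j; rewrite [RHS]mxE.
  have := free (fun j => row i (kermx B) 0 j) _ j; apply.
  by rewrite -[LHS]to_realK -E to_complex0.
exists (fun i => (to_real z *m invmx B) 0 i).
have := rB (to_real z *m invmx B); rewrite mulmxKV // => /(congr1 (@to_complex _ _)).
by rewrite !to_realK.
Qed.

(** Subtracting the integer parts of the real coordinates of [z] moves it into the fundamental
    parallelepiped, where each basis vector has a coefficient in [0, 1). *)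
Lemma lattice_bounded (Gamma : set 'rV[C]_m) (d : nat) (L : 'rV[C]_m -> 'rV[R]_d) :
  lattice Gamma -> {morph L : z w / z + w} ->
  (forall (a : R) z, L (a%:C%C *: z) = a *: L z) ->
  exists K, forall z, exists2 g, Gamma g & `|L (z + g)| <= K.
Proof.
case=> b [free ->] LD LZ; exists (\sum_i `|L (b i)|) => z.
have [t ->] := lattice_span free z.
exists (\sum_i b i *~ - Num.floor (t i)).
  by exists (fun i => - Num.floor (t i)).
rewrite -big_split /=.
have -> : \sum_i ((t i)%:C%C *: b i + b i *~ - Num.floor (t i)) =
    \sum_i (t i - (Num.floor (t i))%:~R)%:C%C *: b i.
  apply: eq_bigr => i _; rewrite rmorphB /= scalerBl; congr (_ + _).
  by rewrite mulrNz rmorph_int scaler_int.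
have L0 : L 0 = 0 by rewrite -(scale0r 0) -[0 : C]/((0 : R)%:C%C) LZ scale0r.
rewrite (big_morph L LD L0); apply: (le_trans (ler_norm_sum _ _ _)).
apply: ler_sum => i _; rewrite LZ normrZ ler_piMl // ger0_norm.
  by rewrite lerBlDr addrC -[1]/(1%:~R) -rmorphD /= ltW // floorD1_gt.
by rewrite subr_ge0 floor_le.
Qed.

End Lattice.

Section ComplexContinuity.
Variables (R : realType) (n N : nat).
Local Notation C := R[i].

Lemma continuousM_rV (f g : 'rV[R]_n -> R) :
  continuous f -> continuous g -> continuous (fun x => f x * g x).
Proof. by move=> cf cg x; apply: continuousM; [exact: cf|exact: cg]. Qed.

Lemma continuousD_rV (f g : 'rV[R]_n -> R) :
  continuous f -> continuous g -> continuous (fun x => f x + g x).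
Proof. by move=> cf cg x; apply: continuousD; [exact: cf|exact: cg]. Qed.

Lemma continuousN_rV (f : 'rV[R]_n -> R) :
  continuous f -> continuous (fun x => - f x).
Proof. by move=> cf x; apply: continuousN; exact: cf. Qed.

Lemma continuous_comp_rV (f : 'rV[R]_n -> R) (g : R -> R) :
  continuous f -> continuous g -> continuous (fun x => g (f x)).
Proof. by move=> cf cg x; apply: continuous_comp; [exact: cf|exact: cg]. Qed.

Lemma continuous_scale_mx (E : 'rV[R]_n -> 'rV[C]_N) :
  (forall j, continuous (fun h => complex.Re (E h 0 j))) ->
  (forall j, continuous (fun h => complex.Im (E h 0 j))) ->
  forall i j, continuous (fun h => scale_mx (E h) i j).
Proof.
move=> cR cI i j; rewrite /scale_mx.
have cd (F : 'rV[R]_n -> 'rV[R]_N) (i' j' : 'I_N) :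
    (forall j, continuous (fun h => F h 0 j)) ->
    continuous (fun h => diag_mx (F h) i' j').
  move=> cF; under eq_fun do rewrite mxE.
  case: (i' == j') => /=; last by move=> ?; exact: cst_continuous.
  by under eq_fun do rewrite mulr1n; exact: cF.
have cRe k : continuous (fun h => map_mx (@complex.Re R) (E h) 0 k).
  by under eq_fun do rewrite mxE; exact: cR.
have cIm k : continuous (fun h => map_mx (@complex.Im R) (E h) 0 k).
  by under eq_fun do rewrite mxE; exact: cI.
case: (split_ordP i) => i' ->; case: (split_ordP j) => j' ->.
- by under eq_fun do rewrite block_mxEul; exact: cd.
- by under eq_fun do rewrite block_mxEur; exact: cd.
- by under eq_fun do rewrite block_mxEdl mxE; apply: continuousN_rV; exact: cd.
- by under eq_fun do rewrite block_mxEdr; exact: cd.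
Qed.

Lemma continuous_cexp (w : 'rV[R]_n -> C) (a : C) :
  continuous (fun h => complex.Re (w h)) -> continuous (fun h => complex.Im (w h)) ->
  continuous (fun h => complex.Re (a * cexp (w h))) /\
  continuous (fun h => complex.Im (a * cexp (w h))).
Proof.
move=> cR cI.
have ce := continuous_comp_rV cR (@continuous_expR R).
have cc := continuous_comp_rV cI (@continuous_cos R).
have cs := continuous_comp_rV cI (@continuous_sin R).
have ca (c : R) : continuous (fun _ : 'rV[R]_n => c) by move=> ?; exact: cst_continuous.
split.
  under eq_fun do rewrite cReM /=.
  apply: continuousD_rV; last apply: continuousN_rV;
    by apply: continuousM_rV; [exact: ca | exact: continuousM_rV].
under eq_fun do rewrite cImM /=.
by apply: continuousD_rV; apply: continuousM_rV; (exact: ca || exact: continuousM_rV).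
Qed.

End ComplexContinuity.

Section HermitianForms.
Variables (R : realType) (m : nat).
Local Notation C := R[i].
Local Notation V := 'rV[C]_m.
Variable H : {hermitian V for false & @Num.conj C}.

Definition hquad (z : V) : R := complex.Re (H z z).

Lemma hermDl u v w : H (u + v) w = H u w + H v w. Proof. exact: linearDl. Qed.
Lemma hermDr u v w : H w (u + v) = H w u + H w v. Proof. exact: linearDr. Qed.
Lemma hermZl a u w : H (a *: u) w = a * H u w. Proof. exact: linearZl_LR. Qed.
Lemma hermZr a u w : H w (a *: u) = Num.conj a * H w u.
Proof. exact: linearZr_LR. Qed.
Lemma herm_conj u v : H u v = Num.conj (H v u).
Proof. by rewrite hermC expr0 mul1r. Qed.

Lemma hquadD z w : hquad (z + w) = hquad z + 2 * complex.Re (H z w) + hquad w.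
Proof.
rewrite /hquad hermDl !hermDr !cReD (herm_conj w z) cReJ; ring.
Qed.

Lemma hquadZ a z : hquad (a *: z) = cnorm2 a * hquad z.
Proof.
rewrite /hquad hermZl hermZr mulrA cReM !cReM !cImM cReJ cImJ /cnorm2; ring.
Qed.

(** Polarisation kills the real part; applied to ['i%C *: u] this also kills the imaginary part. *)
Lemma hquad0_form0 : (forall z, hquad z = 0) -> forall u v, H u v = 0.
Proof.
move=> h0.
have Re0 u v : complex.Re (H u v) = 0.
  have := hquadD u v; rewrite !h0 => /esym/eqP.
  by rewrite addr0 add0r mulf_eq0 pnatr_eq0 => /eqP.
move=> u v; apply: complex_eq; first exact: Re0.
have := Re0 ('i%C *: u) v; rewrite hermZl cReM /= mul0r mul1r sub0r => /eqP.
by rewrite oppr_eq0 => /eqP.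
Qed.

End HermitianForms.

(** * The deck action and its differential along the zero section *)

Section Deck.
Variables (R : realType) (m k : nat).
Local Notation C := R[i].
Local Notation W := 'rV[C]_m.
Local Notation herm := {hermitian W for false & @Num.conj C}.
Local Notation V := 'rV[R]_((m + k) + (m + k)).
Local Notation J := (Jmx R (m + k)).
Variables (H : 'I_k -> herm) (alpha : 'I_k -> W -> C).
Implicit Types (x h u v : V) (gam z w : W).

Definition base_point x : W := lsubmx (to_complex x).
Definition translation gam : V := to_real (row_mx gam 0).

Definition deck_exponent p z gam : C :=
  pi%:C%C * H p z gam + (pi / 2)%:C%C * H p gam gam.

Definition deck_factor gam z : 'rV[C]_(m + k) :=
  row_mx (const_mx 1) (\row_p (alpha p gam * cexp (deck_exponent p z gam))).

Definition fibre p : V := to_real (row_mx 0 (delta_mx 0 p)).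

Lemma base_pointD x h : base_point (x + h) = base_point x + base_point h.
Proof. by rewrite /base_point to_complexD linearD. Qed.

Lemma base_pointZ (a : R) x : base_point (a *: x) = a%:C%C *: base_point x.
Proof. by rewrite /base_point to_complexZ linearZ. Qed.

Lemma base_point_translation gam : base_point (translation gam) = gam.
Proof. by rewrite /base_point to_realK row_mxKl. Qed.

Lemma translationD z w : translation (z + w) = translation z + translation w.
Proof. by rewrite /translation -to_realD add_row_mx addr0. Qed.

Lemma translationZ (a : R) z : translation (a%:C%C *: z) = a *: translation z.
Proof.
have E : row_mx (a%:C%C *: z) (0 : 'rV_k) = a%:C%C *: row_mx z 0.
  by rewrite scale_row_mx scaler0.
by rewrite /translation E to_realZ /= scale0r addr0.
Qed.

Lemma translationJ z : translation ('i%C *: z) = translation z *m J.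
Proof.
have E : row_mx ('i%C *: z) (0 : 'rV_k) = 'i%C *: row_mx z 0.
  by rewrite scale_row_mx scaler0.
by rewrite /translation E to_realZ /= scale0r add0r scale1r.
Qed.

Lemma deck_realE gam x : deck_real H alpha gam x =
  translation gam + x *m scale_mx (deck_factor gam (base_point x)).
Proof.
rewrite /deck_real /deck /translation -[x in RHS]to_complexK -to_real_scale -to_realD.
rewrite to_complexK; congr to_real; apply/rowP => j.
rewrite [RHS]mxE [X in _ = _ + X]mxE /deck_factor.
case: (split_ordP j) => i ->; rewrite ?row_mxEl ?row_mxEr.
  by rewrite [LHS]mxE [X in _ = _ + X * _]mxE [X in X + _]mxE mul1r addrC.
by rewrite !mxE add0r.
Qed.

Lemma herm_base_linear (h : herm) gam :
  linear_form (fun x => complex.Re (h (base_point x) gam)) /\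
  linear_form (fun x => complex.Im (h (base_point x) gam)).
Proof.
split; split=> [u v|a u].
- by rewrite base_pointD hermDl cReD.
- by rewrite base_pointZ hermZl cReM /= mul0r subr0.
- by rewrite base_pointD hermDl cImD.
- by rewrite base_pointZ hermZl cImM /= mul0r addr0.
Qed.

Lemma deck_factor_continuous gam x i j :
  continuous (fun h => scale_mx (deck_factor gam (base_point (x + h))) i j).
Proof.
have ca (c : R) : continuous (fun _ : V => c) by move=> ?; exact: cst_continuous.
have cE p : continuous (fun h => complex.Re (deck_exponent p (base_point (x + h)) gam))
    /\ continuous (fun h => complex.Im (deck_exponent p (base_point (x + h)) gam)).
  have [lR lI] := herm_base_linear (H p) gam.
  have [cR cI] := (smooth_continuous (linear_form_smooth lR),
                   smooth_continuous (linear_form_smooth lI)).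
  rewrite /deck_exponent; split.
    under eq_fun do rewrite cReD cReM /= mul0r subr0 base_pointD hermDl cReD.
    by apply: continuousD_rV => //; apply: continuousM_rV => //; apply: continuousD_rV.
  under eq_fun do rewrite cImD cImM /= mul0r addr0 base_pointD hermDl cImD.
  by apply: continuousD_rV => //; apply: continuousM_rV => //; apply: continuousD_rV.
move: i j; apply: continuous_scale_mx => q; rewrite /deck_factor;
  case: (split_ordP q) => p ->.
- by under eq_fun do rewrite row_mxEl mxE; exact: ca.
- under eq_fun do rewrite row_mxEr mxE.
  by have [cR cI] := cE p; have [] := continuous_cexp (alpha p gam) cR cI.
- by under eq_fun do rewrite row_mxEl mxE; exact: ca.
- under eq_fun do rewrite row_mxEr mxE.
  by have [cR cI] := cE p; have [] := continuous_cexp (alpha p gam) cR cI.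
Qed.

Definition zero_section x := rsubmx (to_complex x) = 0.

Lemma zero_section_translation gam : zero_section (translation gam).
Proof. by rewrite /zero_section to_realK row_mxKr. Qed.

Lemma zero_section_scale x gam z : zero_section x -> x *m scale_mx (deck_factor gam z) = x.
Proof.
move=> x0; rewrite -[LHS]to_complexK -[RHS]to_complexK to_complex_scale; congr to_real.
apply/rowP => j; rewrite mxE /deck_factor.
case: (split_ordP j) => i ->; first by rewrite row_mxEl mxE mul1r.
have -> : to_complex x 0 (rshift m i) = rsubmx (to_complex x) 0 i by rewrite [RHS]mxE.
by rewrite x0 [X in _ * X]mxE mulr0 mxE.
Qed.

Lemma deck_real_zero_section gam x : zero_section x ->
  deck_real H alpha gam x = x + translation gam.
Proof. by move=> x0; rewrite deck_realE zero_section_scale // addrC. Qed.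

(** Every fibre scaling fixes a point of the zero section, so the variation of the factor with the
    base point acts on the increment [h] only and is of second order. *)
Lemma diff_deck_zero_section gam x u : zero_section x ->
  'd (deck_real H alpha gam) x u = u *m scale_mx (deck_factor gam (base_point x)).
Proof.
move=> x0.
rewrite (@diff_of_mulmx _ _ _ _ x (fun h => scale_mx (deck_factor gam (base_point (x + h))))).
- by rewrite addr0.
- move=> h; rewrite deck_realE (deck_real_zero_section _ x0) mulmxDl.
  by rewrite zero_section_scale // addrA [translation _ + x]addrC.
- by move=> i j; exact: deck_factor_continuous.
Qed.

Lemma fibre_scale p (e : 'rV[C]_(m + k)) : fibre p *m scale_mx e =
  complex.Re (e 0 (rshift m p)) *: fibre p + complex.Im (e 0 (rshift m p)) *: (fibre p *m J).
Proof.
rewrite /fibre -to_real_scale -to_realZ; congr to_real; apply/rowP => j.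
rewrite [LHS]mxE [RHS]mxE; case: (split_ordP j) => i ->; rewrite ?row_mxEl ?row_mxEr.
  by rewrite mxE !mulr0.
by rewrite mxE eqxx /=; case: eqP => [->|_] //; rewrite !mulr0.
Qed.

(** Twice the real part of [deck_exponent] is pi times 2 Re H(z, gam) + H(gam, gam), the increment
    of the quadratic form from [z] to [z + gam]: the factor is a multiplicative coboundary. *)
Lemma cnorm2_deck_factor p gam z : `|alpha p gam| = 1 ->
  cnorm2 (deck_factor gam z 0 (rshift m p)) =
  expR (pi * (hquad (H p) (z + gam) - hquad (H p) z)).
Proof.
move=> a1; rewrite /deck_factor row_mxEr mxE cnorm2M (cnorm2_unit a1) mul1r cnorm2_exp.
congr expR; rewrite hquadD /deck_exponent cReD !cReM /= /hquad.
by field.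
Qed.

(** A vector and its J-image are orthogonal and equally long, so a complex scalar multiplies the
    squared length by its squared modulus. *)
Lemma inner_fibre_scale (S : V -> 'M[R]_((m + k) + (m + k))) x p e :
  (S x)^T = S x -> (forall u v, inner S x (u *m J) (v *m J) = inner S x u v) ->
  inner S x (fibre p *m scale_mx e) (fibre p *m scale_mx e) =
  cnorm2 (e 0 (rshift m p)) * inner S x (fibre p) (fibre p).
Proof.
move=> Ss SJ; rewrite fibre_scale; move: (fibre p) => f.
have f0 : inner S x f (f *m J) = 0.
  have := SJ f (f *m J); rewrite mulmxJJ innerNr innerC // => /eqP.
  by rewrite eq_sym -addr_eq0 -mulr2n mulrn_eq0 => /eqP.
rewrite innerDl !innerDr !innerZl !innerZr SJ f0 (innerC (f *m J)) // f0 /cnorm2.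
by ring.
Qed.

End Deck.

(** * Vanishing of the Hermitian forms *)

Section VanishingChern.
Variables (R : realType) (m k : nat).
Local Notation C := R[i].
Local Notation W := 'rV[C]_m.
Local Notation herm := {hermitian W for false & @Num.conj C}.
Local Notation V := 'rV[R]_((m + k) + (m + k)).
Local Notation J := (Jmx R (m + k)).

Lemma smooth_hquad (h : herm) : smooth (fun x : V => hquad h (base_point x)).
Proof.
have lf w : linear_form (fun x : V => complex.Re (h (base_point x) w)).
  have [H1 _] := @herm_base_linear R m k h w.
  exact H1.
rewrite /hquad; have -> : (fun x : V => complex.Re (h (base_point x) (base_point x))) =
  fun x => \sum_i x 0 i * complex.Re (h (base_point x) (base_point (evec R i))).
  apply/funext => x; rewrite (linear_form_coord x (lf (base_point x))).
  by apply: eq_bigr => i _; rewrite [in RHS]herm_conj cReJ.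
apply: smooth_sum => i; apply: smoothM; apply: linear_form_smooth => //.
by split=> [u v|a u]; rewrite mxE.
Qed.

Variables (Gamma : set W) (lG : lattice Gamma).

(* A positive subharmonic function on the zero section which is multiplied by
   [expR (sg * pi * (h (z + gam) - h z))] under [gam] is [expR (sg * pi * h)] up to
   bounded factors, so it would decay along a line on which [sg * h < 0]. *)
Lemma quasi_periodic_sign (h : herm) (sg : R) (f : V -> R) :
  smooth f -> (forall x, 0 < f x) ->
  (forall x v, 0 <= 'D_v ('D_v f) x + 'D_(v *m J) ('D_(v *m J) f) x) ->
  (forall gam z, Gamma gam -> f (translation k (z + gam)) =
     expR (sg * pi * (hquad h (z + gam) - hquad h z)) * f (translation k z)) ->
  forall v, 0 <= sg * hquad h v.
Proof.
move=> sf f0 lapf fG v; rewrite leNgt; apply/negP => hv.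
(* The exponential absorbs the automorphy factor, so [F] is periodic along the zero section and
   bounded there by compactness. *)
pose F x := f x * expR (- (sg * pi) * hquad h (base_point x)).
have cF : continuous F.
  apply: continuousM_rV; first exact: smooth_continuous.
  apply: continuous_comp_rV; last exact: continuous_expR.
  apply: continuousM_rV; last exact/smooth_continuous/smooth_hquad.
  by move=> ?; exact: cst_continuous.
have FG gam z : Gamma gam -> F (translation k (z + gam)) = F (translation k z).
  move=> Ggam; rewrite /F (fG _ _ Ggam) !base_point_translation mulrAC -expRD mulrC.
  by congr (_ * expR _); ring.
have [K HK] := lattice_bounded lG (@translationD R m k) (@translationZ R m k).
have [M HM] := bounded_on_ball K cF.
have FM z : F (translation k z) <= M.
  by have [gam Ggam /HM] := HK z; rewrite FG.
have fM z : f (translation k z) <= M * expR (sg * pi * hquad h z).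
  rewrite -ler_pdivrMr ?expR_gt0 // -expRN.
  by have := FM z; rewrite /F base_point_translation mulNr.
pose c := - (sg * hquad h v) * pi.
have c0 : 0 < c by rewrite mulr_gt0 ?pi_gt0 // oppr_gt0.
have planeE s t : 0 + s *: translation k v + t *: (translation k v *m J) =
    translation k ((s +i* t)%C *: v).
  have -> : (s +i* t)%C *: v = s%:C%C *: v + t%:C%C *: ('i%C *: v).
    by rewrite scalerA -scalerDl; congr (_ *: _); apply: complex_eq => /=; ring.
  by rewrite translationD !translationZ translationJ add0r.
have fline s t : f (0 + s *: translation k v + t *: (translation k v *m J)) <=
    M * expR (- (c * (s ^+ 2 + t ^+ 2))).
  rewrite planeE (le_trans (fM _)) // hquadZ /cnorm2 /=.
  have -> // : sg * pi * ((s ^+ 2 + t ^+ 2) * hquad h v) = - (c * (s ^+ 2 + t ^+ 2)).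
  by rewrite /c; ring.
have M0 : 0 <= M.
  by apply: le_trans (FM 0); rewrite mulr_ge0 ?expR_ge0 ?ltW.
(* The Gaussian bound [fline] is at most [M]; constancy on the complex line through [v] then
   contradicts its decay. *)
have fconst := subharmonic_constant sf (lapf ^~ (translation k v)) (x := 0) (M := M) _.
have f0M s : f 0 <= M * expR (- (c * s ^+ 2)).
  have := fline s 0; rewrite fconst ?expr0n ?addr0 // => s' t'.
  apply: (le_trans (fline s' t')); rewrite ler_piMr // -expR0 ler_expR oppr_le0.
  by rewrite mulr_ge0 ?addr_ge0 ?sqr_ge0 ?ltW.
have cf : 0 < c * f 0 by rewrite mulr_gt0.
(* From [f 0 * expR (c * s ^+ 2) <= M] and [1 + y <= expR y], it is enough that
   [f 0 + c * f 0 * s ^+ 2] exceed [M]; since [s >= 1], the square may be replaced by [s]. *)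
have [s s1 cfs] : exists2 s, 1 <= s & c * f 0 * s = c * f 0 + M.
  exists (1 + M / (c * f 0)); first by rewrite lerDl divr_ge0 // ltW.
  by rewrite mulrDr mulr1 mulrCA divff ?mulr1 // gt_eqF.
have := f0M s; rewrite expRN -ler_pdivrMr ?invr_gt0 ?expR_gt0 // invrK leNgt.
move=> /negP; apply.
apply: (@lt_le_trans _ _ (f 0 * (1 + c * s ^+ 2))); last first.
  by rewrite ler_pM2l // expR_ge1Dx.
apply: (@lt_le_trans _ _ (f 0 + (c * f 0 * s))).
  by rewrite cfs addrA ltrDr addr_gt0.
rewrite mulrDr mulr1 lerD2l [f 0 * _]mulrCA [c * (_ * _)]mulrA ler_pM2l // expr2.
by rewrite ler_peMl // (le_trans ler01).
Qed.

End VanishingChern.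

(** * Subharmonicity of squared lengths for the metric and for the dual metric *)

Section FlatKahlerSubharmonic.
Variables (R : realType) (N : nat) (g : 'rV[R]_(N + N) -> 'M[R]_(N + N)).
Local Notation V := 'rV[R]_(N + N).
Local Notation J := (Jmx R N).
Hypotheses (kg : kahler_metric g) (fg : flat g).

Let mg : riemannian_metric g. Proof. by case: kg. Qed.
Let smg : smooth_mx g. Proof. by case: mg. Qed.

Definition cometric (x : V) : 'M[R]_(N + N) := invmx (g x).

Lemma smooth_cometric : smooth_mx cometric.
Proof. by apply: smooth_invmx => // x; exact: metric_unit. Qed.

Lemma cometric_sym x : (cometric x)^T = cometric x.
Proof. by rewrite /cometric trmx_inv (metric_sym mg). Qed.

Lemma inner_cometric x u v : inner cometric x u v = inner g x (u *m cometric x) (v *m cometric x).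
Proof.
rewrite !innerE trmx_mul cometric_sym mulmxA; congr ((_ *m _) _ _).
by rewrite -mulmxA /cometric mulmxV ?mulmx1 // metric_unit.
Qed.

Lemma cometric_pos x u : u != 0 -> 0 < inner cometric x u u.
Proof.
move=> u0; rewrite inner_cometric; apply: (metric_pos mg).
apply: contra_neq u0 => E; have := mulmxKV (metric_unit mg x) u.
by rewrite -/(cometric x) E mul0mx.
Qed.

Lemma metric_J x : J *m g x *m J^T = g x.
Proof.
have gJ u v : inner g x (u *m J) (v *m J) = inner g x u v by case: kg.
apply: eq_mx_rows => u; apply: trmx_inj; apply: eq_mx_rows => v; apply: trmx_inj.
apply/rowP => i; rewrite ord1 !trmx_mul !trmxK.
by have := gJ u v; rewrite !innerE trmx_mul !mulmxA.
Qed.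

Lemma cometric_mulJ x u v : inner cometric x (u *m J) (v *m J) = inner cometric x u v.
Proof.
rewrite !innerE trmx_mul !mulmxA; congr ((_ *m _) _ _); rewrite -!mulmxA; congr (_ *m _).
have JT : J^T *m J = 1%:M by rewrite trmx_Jmx mulNmx JmxK opprK.
have JT' : J *m J^T = 1%:M by rewrite trmx_Jmx mulmxN JmxK opprK.
have ug := metric_unit mg x.
apply: (can_inj (mulmxK ug)); rewrite /cometric mulVmx // -{2}(metric_J x) !mulmxA.
rewrite -(mulmxA _ J^T J) JT mulmx1 -(mulmxA _ (invmx _)) mulVmx // mulmx1.
exact: JT'.
Qed.

(** Differentiating [g *m cometric = 1] shows that the dual metric is compatible with minus the
    transposed connection. *)
Lemma derive_cometric x v : 'D_v cometric x =
  - (connection g x v)^T *m cometric x + cometric x *m (- (connection g x v)^T)^T.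
Proof.
have sQ := smooth_cometric.
have ug := metric_unit mg x.
have gQ : g x *m cometric x = 1%:M by rewrite mulmxV.
have Qg : cometric x *m g x = 1%:M by rewrite mulVmx.
have : 'D_v (fun y => g y *m cometric y) x = 0.
  have -> : (fun y => g y *m cometric y) = fun=> 1%:M.
    by apply/funext => y; rewrite /cometric mulmxV // metric_unit.
  exact: derive_cst.
rewrite derive_mulmx // addrC => /eqP; rewrite addr_eq0 => /eqP DQ.
transitivity (cometric x *m (g x *m 'D_v cometric x)).
  by rewrite mulmxA Qg mul1mx.
rewrite DQ mulmxN (derive_metric mg) mulmxDl mulmxDr.
rewrite -(mulmxA (connection g x v)) gQ mulmx1 -(mulmxA (g x)) (mulmxA _ (g x)) Qg mul1mx.
by rewrite linearN /= trmxK mulNmx mulmxN opprD addrC.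
Qed.

Lemma flat_kahler_subharmonic x v e :
  'D_v ('D_v (fun y => inner g y e e)) x +
  'D_(v *m J) ('D_(v *m J) (fun y => inner g y e e)) x =
  2 * (inner g x (e *m connection g x v) (e *m connection g x v) +
       inner g x (e *m connection g x (v *m J)) (e *m connection g x (v *m J))).
Proof.
apply: (@bochner R _ g (fun y => connection g y v)
  (fun y => connection g y (v *m J)) v (v *m J)) => //.
- exact: metric_sym.
- exact: smooth_connection.
- exact: smooth_connection.
- by move=> y; exact: derive_metric.
- by move=> y; exact: derive_metric.
- by move=> y; exact: flat_kahler_harmonic.
- by move=> y; exact: connection_sqr.
Qed.

(** Passing from a matrix to minus its transpose preserves both the vanishing sum of derivatives and
    the vanishing sum of squares, so [bochner] applies again. *)
Lemma flat_kahler_subharmonic_cometric x v e :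
  0 <= 'D_v ('D_v (fun y => inner cometric y e e)) x +
  'D_(v *m J) ('D_(v *m J) (fun y => inner cometric y e e)) x.
Proof.
have sC w : smooth_mx (fun y => - (connection g y w)^T).
  by apply/smooth_mxN/smooth_trmx; exact: smooth_connection.
have dC w y : 'D_w (fun y => - (connection g y w)^T) y = - ('D_w (fun y => connection g y w) y)^T.
  have -> : (fun y => - (connection g y w)^T) = - (fun y => (connection g y w)^T) by [].
  rewrite deriveN; last by apply/smooth_mx_derivable/smooth_trmx; exact: smooth_connection.
  by rewrite derive_trmx //; exact: smooth_connection.
rewrite (@bochner _ _ _ (fun y => - (connection g y v)^T)
  (fun y => - (connection g y (v *m J))^T)) //.
- rewrite mulr_ge0 // addr_ge0 // inner_cometric; exact: metric_ge0.
- exact: smooth_cometric.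
- exact: cometric_sym.
- by move=> y; exact: derive_cometric.
- by move=> y; exact: derive_cometric.
- by move=> y; rewrite !dC -opprD -linearD /= flat_kahler_harmonic // trmx0 oppr0.
- by move=> y; rewrite !mulNmx !mulmxN !opprK -!trmx_mul -linearD /= connection_sqr // trmx0.
Qed.

End FlatKahlerSubharmonic.

Section HermitianFormsVanish.
Variables (R : realType) (m k : nat).
Local Notation C := R[i].
Local Notation W := 'rV[C]_m.
Local Notation herm := {hermitian W for false & @Num.conj C}.
Local Notation V := 'rV[R]_((m + k) + (m + k)).
Local Notation J := (Jmx R (m + k)).
Variables (Gamma : set W) (H : 'I_k -> herm) (alpha : 'I_k -> W -> C).

Theorem hermitian_forms_vanish g : lattice Gamma ->
  (forall p, appell_humbert Gamma (H p) (alpha p)) ->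
  complete_flat_kahler Gamma H alpha g -> forall p u v, H p u v = 0.
Proof.
move=> lG AH [ig kg fg _] p.
have mg : riemannian_metric g by case: kg.
have smg : smooth_mx g by case: mg.
have gJ x u v : inner g x (u *m J) (v *m J) = inner g x u v by case: kg.
have fp0 : fibre R m p != 0.
  apply/negP => /eqP /(congr1 (@to_complex _ _)); rewrite to_realK to_complex0.
  move/rowP/(_ (rshift m p)); rewrite row_mxEr !mxE !eqxx /= => /eqP.
  by rewrite oner_eq0.
pose A gam z := scale_mx (deck_factor H alpha gam z).
(* Deck invariance at zero-section points as a congruence of matrices; inverting it gives the rule
   [QA] for the dual metric. *)
have gA gam z : Gamma gam -> g (translation k z) =
    A gam z *m g (translation k (z + gam)) *m (A gam z)^T.
  move=> Ggam; have z0 := @zero_section_translation R m k z.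
  have := ig gam Ggam (translation k z).
  rewrite deck_real_zero_section // -translationD => E.
  apply: eq_mx_rows => u; apply: trmx_inj; apply: eq_mx_rows => v; apply: trmx_inj.
  apply/rowP => i; rewrite ord1 !trmx_mul !trmxK.
  have := E u v; rewrite !diff_deck_zero_section // base_point_translation.
  by rewrite !innerE trmx_mul !mulmxA.
have cA q gam z : Gamma gam -> cnorm2 (deck_factor H alpha gam z 0 (rshift m q)) =
    expR (pi * (hquad (H q) (z + gam) - hquad (H q) z)).
  by move=> Ggam; apply: cnorm2_deck_factor; have [_ /(_ gam Ggam)] := AH q.
have uA gam z : Gamma gam -> A gam z \in unitmx.
  move=> Ggam; apply: scale_mx_unit => j; case: (split_ordP j) => i ->.
    by rewrite /deck_factor row_mxEl mxE oner_eq0.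
  apply/eqP => E; have := cA i gam z Ggam; rewrite E /cnorm2 /= !expr0n addr0.
  by move/eqP; rewrite lt_eqF // expR_gt0.
have QA gam z : Gamma gam -> cometric g (translation k (z + gam)) =
    (A gam z)^T *m cometric g (translation k z) *m A gam z.
  move=> Ggam; have ug y := metric_unit mg y.
  apply: (can_inj (mulKmx (ug (translation k (z + gam))))).
  rewrite {1}/cometric mulmxV //.
  apply: (can_inj (mulKmx (uA _ z Ggam))).
  by rewrite mulmx1 !mulmxA -gA // /cometric mulmxV // mul1mx.
have pos1 x : 0 < inner g x (fibre R m p) (fibre R m p) by exact: metric_pos.
have pos2 x : 0 < inner (cometric g) x (fibre R m p) (fibre R m p).
  exact: cometric_pos.
apply: hquad0_form0 => v; apply/eqP; rewrite eq_le; apply/andP; split.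
(* The metric is multiplied by the inverse factor, so it is used with [sg = -1] and bounds the form
   above by 0. *)
- rewrite -oppr_ge0 -mulN1r.
  apply: (quasi_periodic_sign lG (smooth_inner (fibre R m p) (fibre R m p) smg)) => //.
    move=> x w; rewrite flat_kahler_subharmonic // mulr_ge0 // addr_ge0 //;
      exact: metric_ge0.
  move=> gam z Ggam.
  have E : inner g (translation k z) (fibre R m p) (fibre R m p) =
      expR (pi * (hquad (H p) (z + gam) - hquad (H p) z)) *
      inner g (translation k (z + gam)) (fibre R m p) (fibre R m p).
    rewrite -cA // -inner_fibre_scale //; last exact: metric_sym.
    by rewrite !innerE (gA gam z Ggam) trmx_mul !mulmxA.
  by rewrite E mulrA -expRD mulN1r mulNr addNr expR0 mul1r.
(* The dual metric is multiplied by the factor itself, so it is used with [sg = 1] and bounds the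
   form below by 0. *)
- rewrite -[hquad _ _]mul1r.
  apply: (quasi_periodic_sign lG (smooth_inner (fibre R m p) (fibre R m p)
    (smooth_cometric kg))) => //.
    by move=> x w; exact: flat_kahler_subharmonic_cometric.
  move=> gam z Ggam; rewrite mul1r -cA //.
  (* The dual rule involves the transposed matrix, whose complex entries are conjugated; only their
     moduli matter. *)
  have <- : cnorm2 (map_mx Num.conj (deck_factor H alpha gam z) 0 (rshift m p)) =
      cnorm2 (deck_factor H alpha gam z 0 (rshift m p)).
    by rewrite mxE /cnorm2 cReJ cImJ sqrrN.
  rewrite -inner_fibre_scale; [|exact: cometric_sym|by move=> *; exact: cometric_mulJ].
  by rewrite !innerE QA // -trmx_scale_mx trmx_mul trmxK !mulmxA.
Qed.

End HermitianFormsVanish.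

(** * The Euclidean metric *)

Section TrivialForms.
Variables (R : realType) (m k : nat).
Local Notation C := R[i].
Local Notation W := 'rV[C]_m.
Local Notation herm := {hermitian W for false & @Num.conj C}.
Local Notation V := 'rV[R]_((m + k) + (m + k)).
Local Notation J := (Jmx R (m + k)).
Variables (Gamma : set W) (H : 'I_k -> herm) (alpha : 'I_k -> W -> C).
Hypothesis AH : forall p, appell_humbert Gamma (H p) (alpha p).
Hypothesis H0 : forall p u v, H p u v = 0.

Definition deck_unitary (gam : W) : 'rV[C]_(m + k) :=
  row_mx (const_mx 1) (\row_p alpha p gam).

Lemma deck_factor_trivial gam z : deck_factor H alpha gam z = deck_unitary gam.
Proof.
congr row_mx; apply/rowP => p; rewrite !mxE /deck_exponent !H0 !mulr0 addr0.
by rewrite cexp0 mulr1.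
Qed.

Lemma deck_real_trivial gam (x : V) : deck_real H alpha gam x =
  translation k gam + x *m scale_mx (deck_unitary gam).
Proof. by rewrite deck_realE deck_factor_trivial. Qed.

Lemma diff_deck_trivial gam (x u : V) :
  'd (deck_real H alpha gam) x u = u *m scale_mx (deck_unitary gam).
Proof.
rewrite (@diff_of_mulmx _ _ _ _ x (fun=> scale_mx (deck_unitary gam))) //.
  by move=> h; rewrite !deck_real_trivial mulmxDl addrA.
by move=> i j; exact: cst_continuous.
Qed.

Lemma deck_unitary_norm gam j : Gamma gam -> `|deck_unitary gam 0 j| = 1.
Proof.
move=> Ggam; rewrite /deck_unitary; case: (split_ordP j) => i ->.
  by rewrite row_mxEl mxE normr1.
by rewrite row_mxEr mxE; have [_ /(_ _ Ggam)] := AH i.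
Qed.

Lemma scale_deck_unitary gam : Gamma gam ->
  scale_mx (deck_unitary gam) *m (scale_mx (deck_unitary gam))^T = 1%:M.
Proof.
move=> Ggam; apply: eq_mx_rows => x; rewrite mulmx1 mulmxA trmx_scale_mx.
rewrite -[RHS]to_complexK -[LHS]to_complexK !to_complex_scale; congr to_real.
apply/rowP => j; rewrite mxE [map_mx _ _ _ _]mxE [X in _ * X]mxE mulrA.
by rewrite [X in X * _]mulrC -normCK deck_unitary_norm // expr1n mul1r.
Qed.

End TrivialForms.

Section Euclidean.
Variable R : realType.

Definition euclidean d (x : 'rV[R]_d) : 'M[R]_d := 1%:M.

Lemma inner_euclidean d (x u v : 'rV[R]_d) : inner (@euclidean d) x u v = (u *m v^T) 0 0.
Proof. by rewrite innerE mulmx1. Qed.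

Lemma partial_cst d i (a : R) : partial i (fun _ : 'rV[R]_d => a) = fun=> 0.
Proof. by apply/funext => x; exact: derive_cst. Qed.

Lemma christoffel_euclidean d i j l : christoffel (@euclidean d) i j l = fun=> 0.
Proof.
apply/funext => x; rewrite /christoffel big1 ?mulr0 // => q _.
by rewrite !partial_cst addr0 subr0 mulr0.
Qed.

Lemma flat_euclidean d : flat (@euclidean d).
Proof.
move=> i j l q x; rewrite /curvature.
under eq_bigr do rewrite !christoffel_euclidean /= !mul0r subrr.
by rewrite !christoffel_euclidean !partial_cst subrr add0r big1.
Qed.

Lemma riemannian_euclidean d : riemannian_metric (@euclidean d).
Proof.
split=> [i j|x|x u u0]; first exact: smooth_cst.
  exact: trmx1.
rewrite inner_euclidean mxE lt_neqAle; apply/andP; split; last first.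
  by apply: sumr_ge0 => i _; rewrite mxE -expr2 sqr_ge0.
apply: contra_neq u0 => /esym/eqP.
rewrite psumr_eq0; last by move=> i _; rewrite mxE -expr2 sqr_ge0.
move=> /allP E; apply/rowP => i; rewrite [RHS]mxE; apply/eqP.
by have := E i (mem_index_enum _); rewrite mxE -expr2 sqrf_eq0.
Qed.

Lemma complete_euclidean d : geodesically_complete (@euclidean d).
Proof.
move=> x v; exists (fun t => x + t *: v).
have D t : is_derive (t : R) (1 : R) (fun t => x + t *: v) v.
  have d1 : differentiable (fun t : R => t *: v) t by exact: ex_diff.
  have d2 : is_derive t (1 : R) (fun t : R => t *: v) v.
    by apply: DeriveDef; [exact: diff_derivable | rewrite deriveE // diff_val scale1r].
  by apply: (is_derive_eq (is_deriveD (is_derive_cst x t 1) d2)); rewrite add0r.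
have D1 : derive1 (fun t : R => x + t *: v) = fun=> v.
  by apply/funext => t; rewrite derive1E; have [_ ->] := D t.
split; last by rewrite D1.
  split=> [t|t|t l]; first by have [] := D t.
    by rewrite D1; exact: derivable_cst.
  rewrite D1 derive1E derive_cst mxE big1 ?oppr0 // => i _.
  by rewrite big1 // => j _; rewrite christoffel_euclidean /= !mul0r.
by rewrite scale0r addr0.
Qed.

Lemma kahler_euclidean N : kahler_metric (@euclidean (N + N)).
Proof.
split; first exact: riemannian_euclidean.
  move=> x u v; rewrite !inner_euclidean trmx_mul mulmxA -(mulmxA u).
  by rewrite trmx_Jmx mulmxN JmxK opprK mulmx1.
have K (w1 w2 : 'rV[R]_(N + N)) : (fun y => kahler_form (@euclidean (N + N)) y w1 w2) =
    fun=> (w1 *m Jmx R N *m w2^T) 0 0.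
  by apply/funext => y; exact: inner_euclidean.
by move=> i j l x /=; rewrite !K !partial_cst !addr0.
Qed.

Lemma complete_flat_kahler_euclidean m k (Gamma : set 'rV[R[i]]_m)
    (H : 'I_k -> {hermitian 'rV[R[i]]_m for false & @Num.conj R[i]})
    (alpha : 'I_k -> 'rV[R[i]]_m -> R[i]) :
  (forall p, appell_humbert Gamma (H p) (alpha p)) ->
  (forall p u v, H p u v = 0) ->
  complete_flat_kahler Gamma H alpha (@euclidean ((m + k) + (m + k))).
Proof.
move=> AH H0; split; [|exact: kahler_euclidean|exact: flat_euclidean|exact: complete_euclidean].
move=> gam Ggam x u v; rewrite !inner_euclidean !diff_deck_trivial //.
by rewrite trmx_mul mulmxA -(mulmxA u) (scale_deck_unitary AH) ?mulmx1.
Qed.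

End Euclidean.

(** * Functions of two real variables *)

Section TwoVariables.
Variable R : realType.
Implicit Types (F : R -> R -> R) (s t : R).

(** The partial derivatives are part of the data, so Cauchy-Riemann equations can be stated by
    repeating the same functions. *)
Definition C1_with F (F1 F2 : R -> R -> R) :=
  [/\ forall s t, is_derive s (1 : R) (F ^~ t) (F1 s t),
      forall s t, is_derive t (1 : R) (F s) (F2 s t),
      continuous (fun p : R * R => F1 p.1 p.2)
    & continuous (fun p : R * R => F2 p.1 p.2)].

Lemma MVT_signed (h h' : R -> R) (a x : R) : (forall t, is_derive t (1 : R) h (h' t)) ->
  exists2 y, `|y| <= `|x| & h (a + x) - h a = x * h' (a + y).
Proof.
move=> dh.
have ch (A : set R) : {within A, continuous h}.
  by apply: continuous_subspaceT => t; exact: (is_derive_continuous (dh t)).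
have [x0|x0] := leP 0 x.
  have [c] := @MVT_segment R h h' a (a + x) (ler_wpDr x0 (lexx a)) (fun t _ => dh t) (ch _).
  rewrite in_itv /= [a + x - a]addrAC subrr add0r => /andP[c1 c2] ->.
  exists (c - a); last by rewrite (addrC a (c - a)) subrK mulrC.
  by rewrite !ger0_norm ?subr_ge0 // lerBlDl.
have ax : a + x <= a by rewrite gerDl ltW.
have [c] := @MVT_segment R h h' (a + x) a ax (fun t _ => dh t) (ch _).
rewrite in_itv /= opprD addrA subrr sub0r => /andP[c1 c2] E.
exists (c - a); last by rewrite (addrC a (c - a)) subrK -opprB E mulrN opprK mulrC.
by rewrite !ler0_norm ?subr_le0 ?(ltW x0) // lerN2 lerBrDl.
Qed.

(** Total differentiability from continuous partials: the mean value theorem on the two sides of an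
    L-shaped path. *)
Lemma C1_estimate F F1 F2 s t (e : R) : C1_with F F1 F2 -> 0 < e ->
  exists2 d, 0 < d & forall x y, `|x| < d -> `|y| < d ->
    `|F (s + x) (t + y) - F s t - (x * F1 s t + y * F2 s t)| <= e * (`|x| + `|y|).
Proof.
move=> [d1 d2 c1 c2] e0.
have near1 (G : R -> R -> R) : continuous (fun p : R * R => G p.1 p.2) ->
    exists2 d, 0 < d & forall x y, `|x| < d -> `|y| < d -> `|G (s + x) (t + y) - G s t| <= e.
  move=> cG; have /cvgrPdist_le/(_ e e0) /nbhs_ballP[d /= d0 B] := cG (s, t).
  exists d => // x y xd yd; rewrite distrC; apply: (B (s + x, t + y)).
  by split; rewrite -ball_normE /= opprD addNKr normrN.
have [r1 r10 H1] := near1 _ c1; have [r2 r20 H2] := near1 _ c2.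
exists (Num.min r1 r2); first by rewrite lt_min r10.
move=> x y; rewrite !lt_min => /andP[x1 x2] /andP[y1 y2].
have [x' x'x Ex] := MVT_signed s x (fun z => d1 z (t + y)).
have [y' y'y Ey] := MVT_signed t y (d2 s).
have -> : F (s + x) (t + y) - F s t - (x * F1 s t + y * F2 s t) =
    x * (F1 (s + x') (t + y) - F1 s t) + y * (F2 (s + 0) (t + y') - F2 s t).
  rewrite addr0 !mulrBr -Ex -Ey; ring.
rewrite [e * _]mulrDr (le_trans (ler_normD _ _)) // !normrM lerD // mulrC ler_wpM2r //.
  by apply: H1 => //; exact: le_lt_trans x1.
by apply: H2; [rewrite normr0 | exact: le_lt_trans y2].
Qed.

Lemma is_derive_C1_comp F F1 F2 (d : nat) (a b : 'rV[R]_d -> R) x u :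
  C1_with F F1 F2 -> linear_form a -> linear_form b ->
  is_derive x u (fun y => F (a y) (b y)) (a u * F1 (a x) (b x) + b u * F2 (a x) (b x)).
Proof.
move=> CF [aD aZ] [bD bZ].
suff H : (fun h : R => h^-1 *: (((fun y => F (a y) (b y)) \o shift x) (h *: u)
    - F (a x) (b x))) @ 0^' --> a u * F1 (a x) (b x) + b u * F2 (a x) (b x).
  by apply: DeriveDef; [apply/cvg_ex; eexists; exact: H | apply/cvg_lim].
apply/cvgrPdist_le => e e0.
pose c := `|a u| + `|b u| + 1.
have c0 : 0 < c by rewrite ltr_wpDl // addr_ge0.
have [d1 d10 Hd] := C1_estimate (a x) (b x) CF (divr_gt0 e0 c0).
near=> h.
have h0 : h != 0 by near: h; exact: nbhs_dnbhs_neq.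
have hd : `|h| < d1 / c by near: h; apply: dnbhs0_lt; rewrite divr_gt0.
rewrite /= aD bD aZ bZ [_ + a x]addrC [_ + b x]addrC.
have small (k : R) : `|k| <= c -> `|h * k| < d1.
  move=> kc; rewrite normrM (le_lt_trans (ler_wpM2l _ kc)) // -ltr_pdivlMr //.
have := Hd (h * a u) (h * b u).
rewrite small; last by rewrite /c -addrA lerDl addr_ge0.
rewrite small; last by rewrite /c addrAC lerDr addr_ge0.
move=> /(_ isT isT); set D := F _ _ - F _ _; set l := a u * _ + b u * _.
have -> : h * a u * F1 (a x) (b x) + h * b u * F2 (a x) (b x) = h * l.
  by rewrite /l; ring.
move=> Hle; rewrite distrC.
have -> : h^-1 *: D - l = h^-1 * (D - h * l) by rewrite mulrBr mulKf.
rewrite normrM normfV mulrC ler_pdivrMr ?normr_gt0 // (le_trans Hle) //.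
rewrite !normrM -mulrDr -mulrA ler_pM2l // ler_pdivrMl // mulrC ler_wpM2r //.
by rewrite /c lerDl.
Unshelve. all: by end_near. Qed.

Lemma normc_le_sum (x y : R) : `|(x +i* y)%C| <= (`|x| + `|y|)%:C%C :> R[i].
Proof.
rewrite normc_def /= lecR -[leRHS]ger0_norm ?addr_ge0 // -sqrtr_sqr ler_wsqrtr //.
rewrite sqrrD !real_normK ?num_real // addrAC lerDl mulrn_wge0 // mulr_ge0 //.
Qed.

Lemma normc_ge_parts (z : R[i]) (d : R) : `|z| < d%:C%C ->
  `|complex.Re z| < d /\ `|complex.Im z| < d.
Proof.
rewrite normc_def ltcR => zd; split; apply: le_lt_trans zd; rewrite -sqrtr_sqr;
  apply: ler_wsqrtr; by rewrite ?lerDl ?lerDr sqr_ge0.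
Qed.

Lemma parts_le_normc (z : R[i]) : (`|complex.Re z| + `|complex.Im z|)%:C%C <= 2 * `|z|.
Proof.
rewrite normc_def -[2 : R[i]]/(2%:R) -(rmorph_nat (real_complex R) 2) -rmorphM lecR.
rewrite mulr2n mulrDl !mul1r lerD // -sqrtr_sqr;
  apply: ler_wsqrtr; by rewrite ?lerDl ?lerDr sqr_ge0.
Qed.

(** The second hypothesis contains the Cauchy-Riemann equations; the complex derivative is
    [U1 - i U2]. *)
Lemma holomorphic_CR (U V U1 U2 : R -> R -> R) :
  C1_with U U1 U2 -> C1_with V (fun s t => - U2 s t) U1 ->
  holomorphic (fun w : R[i] => (U (complex.Re w) (complex.Im w)
    +i* V (complex.Re w) (complex.Im w))%C).
Proof.
move=> CU CV; rewrite /holomorphic /= => z.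
set s := complex.Re z; set t := complex.Im z.
apply/cvg_ex; exists (U1 s t +i* - U2 s t)%C.
apply/cvgrPdist_le => e e0.
have [e1 e10 eE] : exists2 e1 : R, 0 < e1 & e = e1%:C%C.
  exists (complex.Re e); first by move: e0; rewrite ltcE => /andP[].
  by case: e e0 => a b; rewrite ltcE /= => /andP[/eqP -> _].
(* A factor 2 is lost by adding the real and imaginary errors, and another by bounding |x| + |y| by
   twice the modulus of [h]. *)
have e4 : 0 < e1 / 4 by rewrite divr_gt0.
have [d1 d10 H1] := C1_estimate s t CU e4.
have [d2 d20 H2] := C1_estimate s t CV e4.
have d0 : 0 < Num.min d1 d2 by rewrite lt_min d10.
near=> h.
have h0 : h != 0 by near: h; exact: nbhs_dnbhs_neq.
have hd : `|h| < (Num.min d1 d2)%:C%C.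
  by near: h; apply: dnbhs0_lt; rewrite ltcR.
have [xd yd] := normc_ge_parts hd.
set x := complex.Re h in xd; set y := complex.Im h in yd.
move: xd yd; rewrite !lt_min => /andP[x1 x2] /andP[y1 y2].
have HU := H1 x y x1 y1; have HV := H2 x y x2 y2.
set f := fun w : R[i] => _; set l := Complex _ _.
have -> : (f \o shift z) (h *: 1) = f (z + h) by rewrite /= [h *: 1]mulr1 addrC.
have E : f (z + h) - f z - h * l =
    Complex (U (s + x) (t + y) - U s t - (x * U1 s t + y * U2 s t))
      (V (s + x) (t + y) - V s t - (x * - U2 s t + y * U1 s t)).
  apply: complex_eq; rewrite /f ?(cReD, cReN, cReM, cImD, cImN, cImM) /=;
    rewrite -/s -/t -/x -/y; ring.
have -> : l - h^-1 *: (f (z + h) - f z) = - (h^-1 * (f (z + h) - f z - h * l)).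
  by rewrite [h^-1 * _]mulrBr mulKf // opprB.
rewrite normrN normrM normfV mulrC ler_pdivrMr ?normr_gt0 // E.
apply: (le_trans (normc_le_sum _ _)).
apply: (@le_trans _ _ ((e1 / 2)%:C%C * (`|x| + `|y|)%:C%C)).
  rewrite -rmorphM lecR; move: HU HV; lra.
apply: (@le_trans _ _ ((e1 / 2)%:C%C * (2 * `|h|))).
  by rewrite ler_wpM2l ?parts_le_normc // ler0c ltW // divr_gt0.
by rewrite mulrA eE -[2 : R[i]](rmorph_nat (real_complex R) 2) -rmorphM divfK // pnatr_eq0.
Unshelve. all: by end_near. Qed.

(** * Primitives of closed one-forms on a real plane *)

Section Primitive.
Variables (d : nat) (f1 f2 : 'rV[R]_d -> R) (a b : 'rV[R]_d).
Hypotheses (sf1 : smooth f1) (sf2 : smooth f2).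
Hypothesis closed12 : forall x, 'D_b f1 x = 'D_a f2 x.

Let P s t : 'rV[R]_d := s *: a + t *: b.
Let I (t s tau : R) : R := s * f1 (tau *: P s t) + t * f2 (tau *: P s t).

(* The integral of [f1 ds + f2 dt] along the segment from the origin to [(s, t)]. *)
Definition potential s t : R :=
  (\int[@lebesgue_measure R]_(tau in `[0%R, 1%R]) I t s tau)%R.

Let is_derive_ray (f : 'rV[R]_d -> R) s t tau : smooth f ->
  is_derive s (1 : R) (fun s => f (tau *: P s t)) (tau * 'D_a f (tau *: P s t)).
Proof.
move=> sf.
have E : (fun s => f (tau *: P s t)) = (fun s => f (tau *: (t *: b) + s *: (tau *: a))).
  by apply/funext => s'; rewrite /P scalerDr addrC !scalerA (mulrC tau s').
rewrite E; have := @is_derive_line R _ f (tau *: (t *: b)) (tau *: a) s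
  (tau * 'D_a f (tau *: P s t)).
apply; have -> : tau *: (t *: b) + s *: (tau *: a) = tau *: P s t.
  by rewrite /P scalerDr addrC !scalerA (mulrC tau s).
by apply: is_derive_dirZ; apply/derivableP/smooth_derivable.
Qed.

Let dI s t tau : R := f1 (tau *: P s t) +
  tau * (s * 'D_a f1 (tau *: P s t) + t * 'D_b f1 (tau *: P s t)).

Let is_derive_I s t tau : is_derive s (1 : R) (fun s => I t s tau) (dI s t tau).
Proof.
have D1 := is_derive_ray s t tau sf1; have D2 := is_derive_ray s t tau sf2.
have D3 := is_deriveD (is_deriveM (is_derive_id s (1 : R)) D1) (is_deriveZ t D2).
have D4 : is_derive s (1 : R) (fun s => I t s tau)
    (s * (tau * 'D_a f1 (tau *: P s t)) + f1 (tau *: P s t) * 1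
     + t * (tau * 'D_a f2 (tau *: P s t))) by exact: D3.
apply: (is_derive_eq D4); rewrite -closed12 /dI; ring.
Qed.

(** By closedness the s-derivative of the integrand is the tau-derivative of
    [tau * f1 (tau *: P s t)], so its integral over [0, 1] telescopes to [f1 (P s t)]. *)
Let is_derive_tau s t tau :
  is_derive tau (1 : R) (fun tau => tau * f1 (tau *: P s t)) (dI s t tau).
Proof.
have D1 : is_derive tau (1 : R) (fun tau => f1 (tau *: P s t)) ('D_(P s t) f1 (tau *: P s t)).
  have -> : (fun tau => f1 (tau *: P s t)) = (fun tau => f1 (0 + tau *: P s t)).
    by apply/funext => u; rewrite add0r.
  by apply: is_derive_line; rewrite add0r; apply/derivableP/smooth_derivable.
have D3 := is_deriveM (is_derive_id tau (1 : R)) D1.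
have D4 : is_derive tau (1 : R) (fun tau => tau * f1 (tau *: P s t))
    (tau * 'D_(P s t) f1 (tau *: P s t) + f1 (tau *: P s t) * 1) by exact: D3.
apply: (is_derive_eq D4); rewrite mulr1 /dI [in LHS]/P.
by rewrite smooth_deriveD // !smooth_deriveZ // addrC.
Qed.

Let continuous_ray (f : 'rV[R]_d -> R) (v : 'rV[R]_d) : smooth f ->
  continuous (fun tau : R => f (tau *: v)).
Proof.
move=> sf; have -> : (fun tau => f (tau *: v)) = (fun tau => f (0 + tau *: v)).
  by apply/funext => u; rewrite add0r.
move=> tau; apply: (@is_derive_continuous R _ tau ('D_v f (0 + tau *: v))).
by apply: is_derive_line; apply/derivableP/smooth_derivable.
Qed.

Let continuous_affine (c1 c2 : R) (h1 h2 : R -> R) : continuous h1 -> continuous h2 ->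
  continuous (fun tau => c1 * h1 tau + c2 * h2 tau).
Proof.
move=> ch1 ch2 tau; apply: cvgD; apply: cvgM; (exact: cvg_cst || exact: ch1 || exact: ch2).
Qed.

Let continuous_dI s t : continuous (dI s t).
Proof.
move=> tau; apply: cvgD; first exact: continuous_ray.
apply: cvgM; first exact: cvg_id.
have c1 := continuous_ray (v := P s t) (smooth_derive a sf1).
have c2 := continuous_ray (v := P s t) (smooth_derive b sf1).
exact: (continuous_affine (c1 := s) (c2 := t) c1 c2).
Qed.

Let integrable01 (h : R -> R) : continuous h ->
  (@lebesgue_measure R).-integrable `[0%R, 1%R] (EFin \o h).
Proof.
move=> ch; apply: continuous_compact_integrable; first exact: segment_compact.
exact: continuous_subspaceT.
Qed.

Let abs_bounded (f : 'rV[R]_d -> R) (K : R) : smooth f ->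
  exists2 M, 0 <= M & forall x, `|x| <= K -> `|f x| <= M.
Proof.
move=> sf.
have [M HM] := @bounded_on_ball R d (fun x => `|f x|) K
  (continuous_comp_rV (smooth_continuous sf) (@norm_continuous _ R)).
exists `|M|; first exact: normr_ge0.
by move=> x xK; apply: (le_trans (HM x xK)); exact: ler_norm.
Qed.

(** The constant dominating function needed to differentiate under the integral sign on the interval
    of radius 1 around [s]. *)
Let bounded_dI s t : exists2 M, 0 <= M &
  forall x tau, s - 1 < x < s + 1 -> 0 <= tau <= 1 -> `|dI x t tau| <= M.
Proof.
pose K := (`|s| + 1) * `|a| + `|t| * `|b|.
have [M1 M10 H1] := abs_bounded K sf1.
have [M2 M20 H2] := abs_bounded K (smooth_derive a sf1).
have [M3 M30 H3] := abs_bounded K (smooth_derive b sf1).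
exists (M1 + ((`|s| + 1) * M2 + `|t| * M3)).
  by rewrite !addr_ge0 ?mulr_ge0 ?addr_ge0.
move=> x tau xs /andP[tau0 tau1].
have xs' : `|x| <= `|s| + 1.
  have -> : x = s + (x - s) by rewrite addrC subrK.
  rewrite (le_trans (ler_normD _ _)) // lerD2l ler_norml.
  by move: xs => /andP[]; lra.
have PK : `|tau *: P x t| <= K.
  rewrite normrZ ger0_norm // (le_trans (ler_piMl _ tau1)) //.
  by rewrite /P (le_trans (ler_normD _ _)) // !normrZ lerD // ler_wpM2r.
rewrite /dI (le_trans (ler_normD _ _)) // lerD ?H1 //.
rewrite normrM ger0_norm // (le_trans (ler_piMl _ tau1)) //.
rewrite (le_trans (ler_normD _ _)) // !normrM.
have h2 := H2 _ PK; have h3 := H3 _ PK.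
by apply: lerD; apply: ler_pM.
Qed.

Lemma is_derive_potential s t :
  is_derive s (1 : R) (fun s => potential s t) (f1 (s *: a + t *: b)).
Proof.
have [M M0 HM] := bounded_dI s t.
have sI : `]s - 1, s + 1[%classic s by rewrite /= in_itv /= gtrBl ltrDl ltr01.
have cI x : continuous (I t x).
  by apply: continuous_affine; exact: continuous_ray.
have iI x : `]s - 1, s + 1[%classic x ->
    (@lebesgue_measure R).-integrable `[0%R, 1%R] (EFin \o I t x).
  by move=> _; exact: integrable01.
have dII x tau : `]s - 1, s + 1[%classic x -> `[0%R, 1%R]%classic tau ->
    derivable ((I t)^~ tau) x 1.
  by move=> _ _; have [] := is_derive_I x t tau.
have iM : (@lebesgue_measure R).-integrable `[0%R, 1%R] (EFin \o (fun=> M)).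
  by apply: integrable01 => x; exact: cst_continuous.
have p1 x tau : partial1of2 (I t) x tau = dI x t tau.
  by rewrite partial1of2E; have [] := is_derive_I x t tau.
have bM x tau : `]s - 1, s + 1[%classic x -> `[0%R, 1%R]%classic tau ->
    `|partial1of2 (I t) x tau| <= M.
  by rewrite p1 /= !in_itv /=; exact: HM.
have dP := @derivable_under_integral R _ _ (@lebesgue_measure R) (I t) `[0%R, 1%R]%classic
  (measurable_itv _) s _ _ sI iI dII _ (fun=> M0) iM bM.
have vP := @differentiation_under_integral R _ _ (@lebesgue_measure R) (I t)
  `[0%R, 1%R]%classic (measurable_itv _) s _ _ sI iI dII _ (fun=> M0) iM bM.
apply: DeriveDef; first exact: dP.
rewrite -derive1E; transitivity
  (\int[@lebesgue_measure R]_(tau in `[0%R, 1%R]) dI s t tau)%R.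
  by rewrite vP; apply: eq_Rintegral => tau _; rewrite p1.
rewrite /Rintegral (@continuous_FTC2 R (dI s t) (fun tau => tau * f1 (tau *: P s t))) //.
- by rewrite -EFinB /= mul0r subr0 mul1r scale1r.
- exact/continuous_subspaceT/continuous_dI.
- have ct (tau : R) : {for tau, continuous (fun tau : R => tau * f1 (tau *: P s t))}.
    exact: (is_derive_continuous (is_derive_tau s t tau)).
  split.
  + by move=> tau _; have [] := is_derive_tau s t tau.
  + by apply: cvg_at_right_filter; exact: ct.
  + by apply: cvg_at_left_filter; exact: ct.
- by move=> tau _; rewrite derive1E; have [] := is_derive_tau s t tau.
Qed.

End Primitive.

Lemma potential_swap (d : nat) (f1 f2 : 'rV[R]_d -> R) a b s t :
  potential f1 f2 a b s t = potential f2 f1 b a t s.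
Proof. by apply: eq_Rintegral => tau _; rewrite addrC [s *: a + _]addrC. Qed.

Lemma closed_form_exact (d : nat) (f1 f2 : 'rV[R]_d -> R) a b :
  smooth f1 -> smooth f2 -> (forall x, 'D_b f1 x = 'D_a f2 x) ->
  C1_with (potential f1 f2 a b) (fun s t => f1 (s *: a + t *: b))
    (fun s t => f2 (s *: a + t *: b)).
Proof.
move=> sf1 sf2 cl.
have cP (f : 'rV[R]_d -> R) : smooth f -> continuous (fun p : R * R => f (p.1 *: a + p.2 *: b)).
  move=> sf p; apply: continuous_comp; last exact: smooth_continuous.
  by apply: cvgD; apply: cvgZr_tmp; [exact: cvg_fst | exact: cvg_snd].
split; [|move=> s t|exact: cP|exact: cP].
  by move=> s t; exact: is_derive_potential.
have -> : potential f1 f2 a b s = fun t => potential f2 f1 b a t s.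
  by apply/funext => t'; exact: potential_swap.
by rewrite addrC; apply: is_derive_potential => // x; rewrite cl.
Qed.

Lemma smooth_plane_C1 (d : nat) (f : 'rV[R]_d -> R) a b : smooth f ->
  C1_with (fun s t => f (s *: a + t *: b)) (fun s t => 'D_a f (s *: a + t *: b))
    (fun s t => 'D_b f (s *: a + t *: b)).
Proof.
move=> sf.
have cP (h : 'rV[R]_d -> R) : smooth h -> continuous (fun p : R * R => h (p.1 *: a + p.2 *: b)).
  move=> sh p; apply: continuous_comp; last exact: smooth_continuous.
  by apply: cvgD; apply: cvgZr_tmp; [exact: cvg_fst | exact: cvg_snd].
split; [move=> s t|move=> s t|exact: (cP _ (smooth_derive a sf))
  |exact: (cP _ (smooth_derive b sf))].
  under eq_fun do rewrite addrC.
  by rewrite addrC; apply: is_derive_line; apply/derivableP/smooth_derivable.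
by apply: is_derive_line; apply/derivableP/smooth_derivable.
Qed.

Lemma C1_with_eq F F1 F2 G1 G2 : C1_with F F1 F2 ->
  (forall s t, F1 s t = G1 s t) -> (forall s t, F2 s t = G2 s t) -> C1_with F G1 G2.
Proof.
move=> CF E1 E2; have -> : G1 = F1 by apply/funext => s; apply/funext => t.
by have -> : G2 = F2 by apply/funext => s; apply/funext => t.
Qed.

Lemma holomorphic_cexp : holomorphic (@cexp R).
Proof.
pose e i s t : R := expR s * (if i then cos t else sin t).
have ce i : continuous (fun p : R * R => e i p.1 p.2).
  move=> p; apply: cvgM.
    by apply: continuous_comp; [exact: cvg_fst | exact: continuous_expR].
  case: i; apply: continuous_comp; try exact: cvg_snd.
    exact: continuous_cos.
  exact: continuous_sin.
have d1 i s t : is_derive s (1 : R) (e i ^~ t) (e i s t).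
  rewrite /e; move: (if i then cos t else sin t) => c.
  have := is_deriveM (is_derive_expR s) (is_derive_cst c s (1 : R)).
  by move/is_derive_eq; apply; rewrite scaler0 add0r [_ *: _]mulrC.
have d2c s t : is_derive t (1 : R) (e true s) (- e false s t).
  have := is_deriveZ (expR s) (is_derive_cos t).
  by move/is_derive_eq; apply; rewrite [_ *: _]mulrN.
have d2s s t : is_derive t (1 : R) (e false s) (e true s t).
  exact: (is_deriveZ (expR s) (is_derive_sin t)).
have cN i : continuous (fun p : R * R => - e i p.1 p.2).
  by move=> p; apply: cvgN; exact: ce.
apply: (@holomorphic_CR (e true) (e false) (e true) (fun s t => - e false s t)).
  by split; [exact: d1|exact: d2c|exact: ce|exact: cN].
have -> : (fun s t => - - e false s t) = e false.
  by apply/funext => s; apply/funext => t; rewrite opprK.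
by split; [exact: d1|exact: d2s|exact: ce|exact: ce].
Qed.

Lemma holomorphic_comp (h1 h2 : R[i] -> R[i]) :
  holomorphic h1 -> holomorphic h2 -> holomorphic (h1 \o h2).
Proof.
move=> H1 H2 K z.
have D1 := proj1 (@derivable1_diffP K K^o h1 (h2 z)) (H1 _).
have D2 := proj1 (@derivable1_diffP K K^o h2 z) (H2 z).
apply/(@derivable1_diffP K K^o (h1 \o h2) z).
exact: (@differentiable_comp K K^o K^o K^o h2 h1 z D2 D1).
Qed.

End TwoVariables.

(** * Flat Kahler metrics on the total space of a line bundle *)

Section FlatLineBundle.
Variable R : realType.
Local Notation C := R[i].
Local Notation V := 'rV[R]_((1 + 1) + (1 + 1)).
Local Notation J := (Jmx R (1 + 1)).
Local Notation Re := (@complex.Re R).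
Local Notation Im := (@complex.Im R).

Definition zcoord (x : V) : C := lsubmx (to_complex x) 0 0.
Definition xicoord (x : V) : C := rsubmx (to_complex x) 0 0.
Definition zdir : V := translation 1 (const_mx 1).
Definition xidir : V := fibre R 1 (ord0 : 'I_1).

Lemma zcoordD x y : zcoord (x + y) = zcoord x + zcoord y.
Proof. by rewrite /zcoord to_complexD linearD mxE. Qed.
Lemma xicoordD x y : xicoord (x + y) = xicoord x + xicoord y.
Proof. by rewrite /xicoord to_complexD linearD mxE. Qed.
Lemma zcoordZ (a : R) x : zcoord (a *: x) = a%:C%C * zcoord x.
Proof. by rewrite /zcoord to_complexZ linearZ mxE. Qed.
Lemma xicoordZ (a : R) x : xicoord (a *: x) = a%:C%C * xicoord x.
Proof. by rewrite /xicoord to_complexZ linearZ mxE. Qed.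
Lemma zcoordJ x : zcoord (x *m J) = 'i%C * zcoord x.
Proof. by rewrite /zcoord to_complexJ linearZ mxE. Qed.
Lemma xicoordJ x : xicoord (x *m J) = 'i%C * xicoord x.
Proof. by rewrite /xicoord to_complexJ linearZ mxE. Qed.
Lemma xicoord_zdir : xicoord zdir = 0.
Proof. by rewrite /xicoord to_realK row_mxKr mxE. Qed.
Lemma xicoord_xidir : xicoord xidir = 1.
Proof. by rewrite /xicoord to_realK row_mxKr mxE !eqxx. Qed.

Lemma coord_decomposition x : x = Re (zcoord x) *: zdir + Im (zcoord x) *: (zdir *m J)
  + (Re (xicoord x) *: xidir + Im (xicoord x) *: (xidir *m J)).
Proof.
rewrite -!to_realZ -to_realD -[LHS]to_complexK; congr to_real.
rewrite !scale_row_mx add_row_mx !scaler0 addr0 add0r -[LHS]hsubmxK; congr row_mx.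
  by apply/rowP => i; rewrite ord1 /zcoord !mxE mulr1.
by apply/rowP => i; rewrite ord1 /xicoord !mxE !eqxx mulr1.
Qed.

Lemma linear_Re_xi : linear_form (fun x => Re (xicoord x)).
Proof.
split=> [u v|a u]; first by rewrite xicoordD cReD.
by rewrite xicoordZ cReM /= mul0r subr0.
Qed.
Lemma linear_Im_xi : linear_form (fun x => Im (xicoord x)).
Proof.
split=> [u v|a u]; first by rewrite xicoordD cImD.
by rewrite xicoordZ cImM /= mul0r addr0.
Qed.
Lemma linear_Re_z : linear_form (fun x => Re (zcoord x)).
Proof.
split=> [u v|a u]; first by rewrite zcoordD cReD.
by rewrite zcoordZ cReM /= mul0r subr0.
Qed.
Lemma linear_Im_z : linear_form (fun x => Im (zcoord x)).
Proof.
split=> [u v|a u]; first by rewrite zcoordD cImD.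
by rewrite zcoordZ cImM /= mul0r addr0.
Qed.

Lemma derive0_const (d : nat) (f : 'rV[R]_d -> R) v : smooth f ->
  (forall x, 'D_v f x = 0) -> forall x s, f (x + s *: v) = f x.
Proof.
move=> sf Df x s.
have D t : is_derive (t : R) (1 : R) (fun t => f (x + t *: v)) 0.
  by rewrite -(Df (x + t *: v)); apply: is_derive_line; exact/derivableP/smooth_derivable.
by rewrite (is_derive_0_is_cst s 0 D) scale0r addr0.
Qed.

Lemma derive_linear_form (d n : nat) (l : 'rV[R]_n -> R) (M : 'rV[R]_d -> 'rV[R]_n) x v :
  linear_form l -> smooth_mx M -> 'D_v (fun y => l (M y)) x = l ('D_v M x).
Proof.
move=> ll sM; rewrite (linear_form_coord _ ll).
have -> : (fun y => l (M y)) = \sum_i (fun y => M y 0 i * l (evec R i)).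
  by apply/funext => y; rewrite fct_sumE; exact: linear_form_coord.
rewrite derive_sum => [|i]; last first.
  by apply/smooth_derivable/smoothM; [exact: sM | exact: smooth_cst].
apply: eq_bigr => i _; rewrite derive_mxE //.
have -> : (fun y => M y 0 i * l (evec R i)) = l (evec R i) \*: (fun y => M y 0 i).
  by apply/funext => y; rewrite mulrC.
by rewrite deriveZ ?[_ *: _]mulrC //; exact/smooth_derivable/sM.
Qed.

Lemma smooth_linear_form_comp (d n : nat) (l : 'rV[R]_n -> R) (M : 'rV[R]_d -> 'rV[R]_n) :
  linear_form l -> smooth_mx M -> smooth (fun y => l (M y)).
Proof.
move=> ll sM; have -> : (fun y => l (M y)) = fun y => \sum_i M y 0 i * l (evec R i).
  by apply/funext => y; exact: linear_form_coord.
by apply: smooth_sum => i; apply: smoothM; [exact: sM | exact: smooth_cst].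
Qed.

Lemma is_derive_linear_form (d : nat) (l : 'rV[R]_d -> R) x v :
  linear_form l -> is_derive x v l (l v).
Proof.
move=> ll; have sid : smooth_mx (id : 'rV[R]_d -> 'rV[R]_d).
  by move=> i j; apply: linear_form_smooth; split=> [u w|a u]; rewrite mxE.
have E := derive_linear_form x v ll sid; rewrite derive_id in E.
by rewrite -E; apply/derivableP/smooth_derivable/linear_form_smooth.
Qed.

Variables (Gamma : set 'rV[C]_1) (H : {hermitian 'rV[C]_1 for false & @Num.conj C}).
Variables (alpha : 'rV[C]_1 -> C) (g : V -> 'M[R]_((1 + 1) + (1 + 1))).
Hypotheses (lG : lattice Gamma) (AH : appell_humbert Gamma H alpha).
Hypothesis cg : complete_flat_kahler Gamma (fun _ : 'I_1 => H) (fun _ => alpha) g.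

Let kg : kahler_metric g. Proof. by case: cg. Qed.
Let fg : flat g. Proof. by case: cg. Qed.
Let mg : riemannian_metric g. Proof. by case: kg. Qed.
Let smg : smooth_mx g. Proof. by case: mg. Qed.
Let gC x u v : inner g x u v = inner g x v u. Proof. exact/innerC/(metric_sym mg). Qed.
Let gJ x u v : inner g x (u *m J) (v *m J) = inner g x u v. Proof. by case: kg. Qed.
Let gJl x u v : inner g x (u *m J) v = - inner g x u (v *m J).
Proof. exact: inner_Jl. Qed.
Let AH' (p : 'I_1) : appell_humbert Gamma ((fun _ : 'I_1 => H) p) ((fun _ => alpha) p).
Proof. exact: AH. Qed.
Let H0 (p : 'I_1) u v : (fun _ : 'I_1 => H) p u v = 0.
Proof. exact: (hermitian_forms_vanish lG AH' cg). Qed.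
Local Notation Con := (connection g).

Let U gam := scale_mx (@deck_unitary R 1 1 (fun _ => alpha) gam).

Let inner_deck gam (x w : V) : Gamma gam ->
  inner g (translation 1 gam + x *m U gam) (w *m U gam) (w *m U gam) = inner g x w w.
Proof.
move=> Ggam; have [ig _ _ _] := cg; have := ig gam Ggam x w w.
rewrite (deck_real_trivial (H := fun _ : 'I_1 => H) _ H0).
by rewrite !(diff_deck_trivial (H := fun _ : 'I_1 => H) _ H0).
Qed.

(** The entries of [U gam] are at most 1 in absolute value, and 4 is the real dimension. The bound
    is uniform in [gam]. *)
Let norm_mulU gam (x : V) : Gamma gam -> `|x *m U gam| <= `|x| * 4%:R.
Proof.
move=> Ggam; rewrite -[4%:R]mulr1; apply: norm_mulmx_le => // i j.
rewrite /U /scale_mx; set E := deck_unitary _ _.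
have E1 q : `|Re (E 0 q)| <= 1 /\ `|Im (E 0 q)| <= 1.
  have := cnorm2_unit (deck_unitary_norm AH' q Ggam).
  rewrite -/E /cnorm2 => HE; have := sqr_ge0 (Re (E 0 q)); have := sqr_ge0 (Im (E 0 q)).
  move: (Re _) (Im _) HE => a b HE b2 a2.
  by split; rewrite ler_norml; apply/andP; split; nra.
have D (F : C -> R) a b : (forall q, `|F (E 0 q)| <= 1) ->
    `|diag_mx (map_mx F E) a b| <= 1.
  move=> HF; rewrite mxE [map_mx _ _ _ _]mxE; case: (a == b) => /=.
    by rewrite mulr1n.
  by rewrite mulr0n normr0.
case: (split_ordP i) => i' ->; case: (split_ordP j) => j' ->.
- by rewrite block_mxEul; apply: D => q; have [] := E1 q.
- by rewrite block_mxEur; apply: D => q; have [] := E1 q.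
- by rewrite block_mxEdl mxE normrN; apply: D => q; have [] := E1 q.
- by rewrite block_mxEdr; apply: D => q; have [] := E1 q.
Qed.

Let translationU z gam : translation 1 z *m U gam = translation 1 z.
Proof.
rewrite /U -(@deck_factor_trivial R 1 1 (fun _ => H) (fun _ => alpha) H0 gam 0).
exact/zero_section_scale/zero_section_translation.
Qed.

(** A lattice element brings [z] back to a bounded region and moves [x] only to [x *m U gam], so the
    values are all taken on one fixed ball. *)
Let inner_bounded (x w : V) : (forall y gam, Gamma gam ->
    inner g y (w *m U gam) (w *m U gam) = inner g y w w) ->
  exists M, forall z, inner g (x + translation 1 z) w w <= M.
Proof.
move=> wU; have [K HK] := lattice_bounded lG (@translationD R 1 1) (@translationZ R 1 1).
have [M HM] := bounded_on_ball (K + `|x| * 4%:R) (smooth_continuous (smooth_inner w w smg)).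
exists M => z; have [gam Ggam Hgam] := HK z.
rewrite -(inner_deck _ _ Ggam) wU //; apply: HM.
rewrite mulmxDl translationU addrCA -translationD [gam + z]addrC.
by rewrite (le_trans (ler_normD _ _)) // [K + _]addrC lerD // norm_mulU.
Qed.

Let trans_plane (s t : R) : s *: zdir + t *: (zdir *m J) = translation 1 (const_mx (s +i* t)%C).
Proof.
rewrite /zdir -translationJ -!translationZ -translationD; congr translation.
by apply/rowP => i; rewrite !mxE; apply: complex_eq; rewrite ?(cReD, cImD, cReM, cImM) /=; ring.
Qed.

(* [inner g w w] is bounded and subharmonic on the line, hence constant, and the
   Bochner formula makes [w *m Con] vanish. *)
Let connection_zdir_row x w : (forall y gam, Gamma gam ->
    inner g y (w *m U gam) (w *m U gam) = inner g y w w) -> w *m Con x zdir = 0.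
Proof.
move=> wU; have [M HM] := inner_bounded x wU.
have sw := smooth_inner w w smg.
have lap (y : V) : 0 <= 'D_zdir ('D_zdir (fun y => inner g y w w)) y +
    'D_(zdir *m J) ('D_(zdir *m J) (fun y => inner g y w w)) y.
  by rewrite flat_kahler_subharmonic // mulr_ge0 // addr_ge0 //; exact: metric_ge0.
have cst := subharmonic_constant sw lap (x := x) (M := M) _.
have {}cst s t : inner g (x + s *: zdir + t *: (zdir *m J)) w w = inner g x w w.
  by apply: cst => s' t'; rewrite -addrA trans_plane.
have DD v : (forall s, inner g (x + s *: v) w w = inner g x w w) ->
    'D_v ('D_v (fun y => inner g y w w)) x = 0.
  move=> cv; have D1 s : 'D_v (fun y => inner g y w w) (x + s *: v) = 0.
    have := is_derive_line (derivableP (smooth_derivable (x := x + s *: v) (v := v) sw)).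
    have -> : (fun t => inner g (x + t *: v) w w) = fun=> inner g x w w.
      by apply/funext => t; rewrite cv.
    by move=> [_ <-]; exact: derive_cst.
  have := is_derive_line (x := x) (v := v) (s := 0)
    (derivableP (smooth_derivable (x := x + 0 *: v) (v := v) (smooth_derive v sw))).
  have -> : (fun t : R => 'D_v (fun y => inner g y w w) (x + t *: v)) = fun=> 0.
    by apply/funext.
  by rewrite scale0r addr0 => -[_ <-]; exact: derive_cst.
have c1 s : inner g (x + s *: zdir) w w = inner g x w w.
  by have := cst s 0; rewrite scale0r addr0.
have c2 s : inner g (x + s *: (zdir *m J)) w w = inner g x w w.
  by have := cst 0 s; rewrite scale0r addr0.
have := etrans (esym (flat_kahler_subharmonic kg fg x zdir w))
  (etrans (congr2 +%R (DD zdir c1) (DD (zdir *m J) c2)) (addr0 0)).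
move=> /eqP; rewrite mulf_eq0 pnatr_eq0 /= paddr_eq0; [|exact: metric_ge0..].
by move=> /andP[/eqP/(metric_eq0 mg)].
Qed.

(** [zdir] is fixed by [U gam] and [xidir] is multiplied by a unit complex number, so both rows
    vanish; the rows of their J-images follow because [Con] commutes with J. *)
Let connection_zdir x : Con x zdir = 0.
Proof.
have r1 : zdir *m Con x zdir = 0.
  by apply: connection_zdir_row => y gam _; rewrite translationU.
have r2 : xidir *m Con x zdir = 0.
  apply: connection_zdir_row => y gam Ggam.
  rewrite inner_fibre_scale ?metric_sym // cnorm2_unit ?mul1r //.
  exact: (deck_unitary_norm AH').
apply: eq_mx_rows => u; rewrite mulmx0 (coord_decomposition u) !mulmxDl -!scalemxAl.
by rewrite -!mulmxA -(connectionJ kg) !mulmxA r1 r2 mul0mx !scaler0 !addr0.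
Qed.

Let connection_zdirJ x : Con x (zdir *m J) = 0.
Proof. by rewrite (connection_mulJ kg) connection_zdir mul0mx. Qed.

Let zdir_connection x v : zdir *m Con x v = 0.
Proof. by rewrite (connection_torsion_free mg) connection_zdir mulmx0. Qed.

Let derive_g v a b x : 'D_v (fun y => inner g y a b) x =
  inner g x (a *m Con x v) b + inner g x a (b *m Con x v).
Proof.
rewrite derive_inner // innerE (derive_metric mg) mulmxDr mulmxDl mxE !innerE.
by rewrite trmx_mul !mulmxA.
Qed.

Let xi_plane s t : V := s *: xidir + t *: (xidir *m J).

Let inner_xi a b x : inner g x a b = inner g (xi_plane (Re (xicoord x)) (Im (xicoord x))) a b.
Proof.
have sab := smooth_inner a b smg.
have D1 (y : V) : 'D_zdir (fun y => inner g y a b) y = 0.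
  by rewrite derive_g connection_zdir !mulmx0 inner0l inner0r addr0.
have D2 (y : V) : 'D_(zdir *m J) (fun y => inner g y a b) y = 0.
  by rewrite derive_g connection_zdirJ !mulmx0 inner0l inner0r addr0.
rewrite {1}(coord_decomposition x) addrC addrA.
by rewrite (derive0_const sab D2 (_ + _)) (derive0_const sab D1).
Qed.

Let c0 : R := inner g 0 zdir zdir.

Let inner_zdir x : inner g x zdir zdir = c0.
Proof.
have s1 := smooth_inner zdir zdir smg.
have D v y : 'D_v (fun y => inner g y zdir zdir) y = 0.
  by rewrite derive_g zdir_connection inner0l inner0r addr0.
have := derive0_const s1 (D x) 0 1.
by rewrite add0r scale1r.
Qed.

Let zdir_neq0 : zdir != 0.
Proof.
apply/eqP => /(congr1 zcoord); rewrite /zcoord to_realK to_complex0 row_mxKl.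
by rewrite !mxE => /eqP; rewrite oner_eq0.
Qed.

Let c0_gt0 : 0 < c0. Proof. exact: (metric_pos mg). Qed.

Let p x := inner g x zdir xidir.
Let q x := inner g x zdir (xidir *m J).
Let r x := inner g x xidir xidir.
(** Squared length of the component of [xidir] orthogonal to the complex line of [zdir]. *)
Let rho x := r x - (p x ^+ 2 + q x ^+ 2) / c0.

Let xidirJ_connection x v : xidir *m J *m Con x v = xidir *m Con x v *m J.
Proof. by rewrite -!mulmxA (connectionJ kg). Qed.

Let inner_coord x u v : inner g x u v =
  c0 * (Re (zcoord u) * Re (zcoord v) + Im (zcoord u) * Im (zcoord v))
  + p x * (Re (zcoord u) * Re (xicoord v) + Re (xicoord u) * Re (zcoord v)
           + Im (zcoord u) * Im (xicoord v) + Im (xicoord u) * Im (zcoord v))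
  + q x * (Re (zcoord u) * Im (xicoord v) + Im (xicoord u) * Re (zcoord v)
           - Im (zcoord u) * Re (xicoord v) - Re (xicoord u) * Im (zcoord v))
  + r x * (Re (xicoord u) * Re (xicoord v) + Im (xicoord u) * Im (xicoord v)).
Proof.
rewrite {1}(coord_decomposition u) {1}(coord_decomposition v).
move: (Re (zcoord u)) (Im (zcoord u)) (Re (xicoord u)) (Im (xicoord u)) => a1 a2 a3 a4.
move: (Re (zcoord v)) (Im (zcoord v)) (Re (xicoord v)) (Im (xicoord v)) => b1 b2 b3 b4.
have J0 e : inner g x e (e *m J) = 0.
  have := gJl x e e; rewrite gC => /eqP; rewrite -addr_eq0 -mulr2n mulrn_eq0 => /eqP //.
have F1 : inner g x (zdir *m J) xidir = - q x by rewrite gJl.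
have F2 : inner g x xidir (zdir *m J) = - q x by rewrite gC.
have F5 : inner g x xidir zdir = p x by rewrite gC.
have F6 : inner g x (xidir *m J) zdir = q x by rewrite gC.
have F7 e : inner g x (e *m J) e = 0 by rewrite gC.
rewrite !(innerDl, innerDr, innerZl, innerZr) !J0 !F7 !gJ F1 F2 F5 F6 !inner_zdir.
rewrite -/(p x) -/(q x) -/(r x); ring.
Qed.

Let rho_gt0 x : 0 < rho x.
Proof.
(* This is that orthogonal component; the sign of [q] comes from moving J across the metric. *)
pose f := - (p x / c0) *: zdir + (q x / c0) *: (zdir *m J) + xidir.
have xif : xicoord f = 1.
  by rewrite /f !xicoordD !xicoordZ xicoordJ xicoord_zdir !mulr0 !add0r xicoord_xidir.
have f0 : f != 0.
  apply/eqP => E; move: xif; rewrite E /xicoord to_complex0 !mxE => /esym/eqP.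
  by rewrite oner_eq0.
have := metric_pos mg x f0; rewrite inner_coord xif.
have ze2 : zcoord xidir = 0 by rewrite /zcoord to_realK row_mxKl mxE.
have ze1 : zcoord zdir = 1 by rewrite /zcoord to_realK row_mxKl mxE.
rewrite /f !zcoordD !zcoordZ zcoordJ ze1 ze2 !mulr1 addr0.
rewrite ?(cReD, cImD, cReM, cImM) /=.
set lhs := (X in 0 < X -> _); suff -> : lhs = rho x by [].
rewrite /lhs /rho; field; exact: lt0r_neq0.
Qed.

Let w x := xidir *m Con x xidir.
(** [cw + i dw] is the complex Christoffel coefficient of the xi-direction along itself; it becomes
    the derivative of log h2. *)
Let cw x := Re (xicoord (w x)).
Let dw x := Im (xicoord (w x)).

Let xidir_connectionJ x : xidir *m Con x (xidir *m J) = w x *m J.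
Proof. by rewrite (connection_mulJ kg) mulmxA. Qed.

Let dp v x : 'D_v p x = inner g x zdir (xidir *m Con x v).
Proof. by rewrite /p derive_g zdir_connection inner0l add0r. Qed.

Let dq v x : 'D_v q x = inner g x zdir (xidir *m Con x v *m J).
Proof. by rewrite /q derive_g zdir_connection inner0l add0r xidirJ_connection. Qed.

Let dr v x : 'D_v r x = 2 * inner g x xidir (xidir *m Con x v).
Proof. by rewrite /r derive_g gC mulr2n mulrDl mul1r. Qed.

Let sp : smooth p. Proof. exact: smooth_inner. Qed.
Let sq : smooth q. Proof. exact: smooth_inner. Qed.
Let sr : smooth r. Proof. exact: smooth_inner. Qed.

(** With [pq2] these are the Cauchy-Riemann equations of p - i q, obtained from complex linearity of
    the connection. *)
Let pq1 x : 'D_(xidir *m J) p x = 'D_xidir q x.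
Proof. by rewrite dp dq xidir_connectionJ. Qed.

Let pq2 x : 'D_(xidir *m J) q x = - 'D_xidir p x.
Proof. by rewrite dp dq xidir_connectionJ mulmxJJ innerNr. Qed.

Let smooth_rho : smooth rho.
Proof.
apply: smoothD => //; apply: smoothN; apply: smoothM; last exact: smooth_cst.
by apply: smoothD; rewrite /GRing.exp /=; apply: smoothM.
Qed.

Let drho v x : 'D_v rho x = 'D_v r x - 2 * (p x * 'D_v p x + q x * 'D_v q x) / c0.
Proof.
have dD f : smooth f -> is_derive x v f ('D_v f x).
  by move=> sf; exact/derivableP/smooth_derivable.
have D1 := is_deriveM (dD _ sp) (dD _ sp); have D2 := is_deriveM (dD _ sq) (dD _ sq).
have D3 := is_deriveB (dD _ sr) (is_deriveZ c0^-1 (is_deriveD D1 D2)).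
have -> : rho = r - c0^-1 \*: (p * p + q * q).
  by apply/funext => y; rewrite /rho /= [_ / c0]mulrC.
have [_ ->] := D3; rewrite -![_ *: _]/(_ * _).
move: ('D_v p x) ('D_v q x) ('D_v r x) => P Q S.
by field; exact: lt0r_neq0.
Qed.

Let ze1 : zcoord zdir = 1. Proof. by rewrite /zcoord to_realK row_mxKl mxE. Qed.
Let ze2 : zcoord xidir = 0. Proof. by rewrite /zcoord to_realK row_mxKl mxE. Qed.

(** The z-component of [w] drops out, since [rho] measures only the part orthogonal to the
    z-line. *)
Let drho1 x : 'D_xidir rho x = 2 * cw x * rho x.
Proof.
rewrite drho dr dp dq -/(w x) !inner_coord !zcoordJ !xicoordJ ze1 ze2 xicoord_zdir xicoord_xidir.
rewrite ?(cReM, cImM) /= /cw /rho.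
by field; exact: lt0r_neq0.
Qed.

Let drho2 x : 'D_(xidir *m J) rho x = - (2 * dw x * rho x).
Proof.
rewrite drho dr dp dq xidir_connectionJ !inner_coord !zcoordJ !xicoordJ.
rewrite ze1 ze2 xicoord_zdir xicoord_xidir ?(cReM, cImM) /= /dw /rho.
by field; exact: lt0r_neq0.
Qed.

Let sw v : smooth_mx (fun x => xidir *m Con x v).
Proof. by apply: smooth_mxM; [exact: smooth_mx_cst | exact: smooth_connection]. Qed.

Let smooth_cw : smooth cw. Proof. exact: (smooth_linear_form_comp linear_Re_xi (sw xidir)). Qed.
Let smooth_dw : smooth dw. Proof. exact: (smooth_linear_form_comp linear_Im_xi (sw xidir)). Qed.

(** The real xi-coordinate of [flat_kahler_harmonic] along [xidir], in which the direction
    [xidir *m J] contributes [- dw]. It makes [dw ds + cw dt] closed, so the harmonic conjugate [T]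
    of [L] exists. *)
Let cw_dw x : 'D_(xidir *m J) dw x = 'D_xidir cw x.
Proof.
have dE v u : 'D_v (fun y => xidir *m Con y u) x = xidir *m 'D_v (fun y => Con y u) x.
  rewrite (derive_mulmx (A := fun=> xidir)); [|exact: smooth_mx_cst|exact: smooth_connection].
  by rewrite derive_cst mul0mx add0r.
have E0 : Re (xicoord ('D_xidir (fun y => xidir *m Con y xidir) x)) +
    Re (xicoord ('D_(xidir *m J) (fun y => xidir *m Con y (xidir *m J)) x)) = 0.
  rewrite (dE xidir xidir) (dE (xidir *m J) (xidir *m J)) -cReD -xicoordD -mulmxDr.
  by rewrite flat_kahler_harmonic // mulmx0 /xicoord to_complex0 !mxE.
have E1 := derive_linear_form x xidir linear_Re_xi (sw xidir).
have E2 := derive_linear_form x (xidir *m J) linear_Re_xi (sw (xidir *m J)).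
have E3 : (fun y => Re (xicoord (xidir *m Con y (xidir *m J)))) = - dw.
  by apply/funext => y; rewrite xidir_connectionJ xicoordJ cReM /= mul0r mul1r sub0r.
rewrite E3 deriveN in E2; last exact: smooth_derivable.
apply/esym/subr0_eq; apply: etrans E0; exact: (congr2 +%R E1 E2).
Qed.

Let f1 x := c0^-1 * p x.
Let f2 x := c0^-1 * q x.
Let nf2 x := - f2 x.
Let sf1 : smooth f1. Proof. by apply: smoothM => //; exact: smooth_cst. Qed.
Let sf2 : smooth f2. Proof. by apply: smoothM => //; exact: smooth_cst. Qed.
Let snf2 : smooth nf2. Proof. exact: smoothN. Qed.

Let Df (h : V -> R) v x : smooth h -> 'D_v (fun y => c0^-1 * h y) x = c0^-1 * 'D_v h x.
Proof. by move=> sh; rewrite -[RHS]deriveZ //; exact: smooth_derivable. Qed.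

Let f12 x : 'D_(xidir *m J) f1 x = 'D_xidir f2 x.
Proof. by rewrite !Df // pq1. Qed.

Let f21 x : 'D_(xidir *m J) nf2 x = 'D_xidir f1 x.
Proof.
have -> : nf2 = - f2 by [].
by rewrite deriveN ?Df ?pq2 ?mulrN ?opprK //; exact: smooth_derivable.
Qed.

Let CA := closed_form_exact sf1 sf2 f12.
Let CB := closed_form_exact snf2 sf1 f21.
Let CT := closed_form_exact smooth_dw smooth_cw cw_dw.

Let A := potential f1 f2 xidir (xidir *m J).
Let B := potential nf2 f1 xidir (xidir *m J).
Let T := potential dw cw xidir (xidir *m J).
(** Logarithm of the wanted modulus of [h2]; [T] supplies the argument. *)
Let L s t : R := ln (rho (xi_plane s t) / 2) / 2.

Let CL : C1_with L (fun s t => cw (xi_plane s t)) (fun s t => - dw (xi_plane s t)).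
Proof.
have [_ _ cd cc] := CT.
have [d1 d2 _ _] := smooth_plane_C1 xidir (xidir *m J) smooth_rho.
have D (h : R -> R) (x : R) (l : R) : 0 < h x -> is_derive x (1 : R) h (2 * l * h x) ->
    is_derive x (1 : R) (fun y => ln (h y / 2) / 2) l.
  move=> hx dh; have hx2 : 0 < 2^-1 * h x by rewrite mulr_gt0.
  have D1 := @is_derive1_comp R (@ln R) (fun y => 2^-1 * h y) x _ _
    (is_derive1_ln hx2) (is_deriveZ 2^-1 dh).
  have D2 := is_deriveZ 2^-1 D1.
  have -> : (fun y => ln (h y / 2) / 2) = (fun y => 2^-1 * ln (2^-1 * h y)).
    by apply/funext => y; rewrite mulrC [h y / 2]mulrC.
  apply: (is_derive_eq D2); rewrite -![_ *: _]/(_ * _); field; exact: lt0r_neq0.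
split.
- move=> s t.
  have := d1 s t; rewrite drho1 => H1.
  exact: (D (fun s => rho (xi_plane s t)) s _ (rho_gt0 _) H1).
- move=> s t.
  have := d2 s t; rewrite drho2 -mulNr -mulrN => H2.
  exact: (D (fun t => rho (xi_plane s t)) t _ (rho_gt0 _) H2).
- exact: cc.
- by move=> y; apply: cvgN; exact: cd.
Qed.

(** [A] and [B] integrate the real and imaginary parts of (p - i q) / c0 d xi. *)
Definition holo1 (z : C) : C := (A (Re z) (Im z) +i* B (Re z) (Im z))%C.
Definition holo2 (z : C) : C := cexp (L (Re z) (Im z) +i* T (Re z) (Im z))%C.

Lemma holomorphic_holo1 : holomorphic holo1.
Proof. exact: (holomorphic_CR CA CB). Qed.

Lemma holomorphic_holo2 : holomorphic holo2.
Proof.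
apply: (@holomorphic_comp R (@cexp R) (fun z => (L (Re z) (Im z) +i* T (Re z) (Im z))%C)).
  exact: holomorphic_cexp.
apply: (holomorphic_CR CL); apply: C1_with_eq CT _ _ => s t //.
by rewrite opprK.
Qed.

Lemma cnorm2_holo2 x : cnorm2 (holo2 (xicoord x)) = rho x / 2.
Proof.
have -> : rho x = rho (xi_plane (Re (xicoord x)) (Im (xicoord x))).
  by rewrite /rho /p /q /r -!inner_xi.
rewrite /holo2 cnorm2_exp /= /L mulrCA divff // mulr1 lnK // posrE divr_gt0 //.
Qed.

Lemma cdiffE (h : V -> C) x u (a b : R) :
  is_derive x u (fun y => Re (h y)) a -> is_derive x u (fun y => Im (h y)) b ->
  cdiff h x u = (a +i* b)%C.
Proof. by rewrite /cdiff => -[_ ->] [_ ->]. Qed.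

Lemma cdiff_conj (h : V -> C) x u (a b : R) :
  is_derive x u (fun y => Re (h y)) a -> is_derive x u (fun y => Im (h y)) b ->
  cdiff (fun y => Num.conj (h y)) x u = (a -i* b)%C.
Proof.
move=> dR dI; apply: cdiffE.
  by under eq_fun do rewrite cReJ.
by under eq_fun do rewrite cImJ; exact: is_deriveN.
Qed.

Definition affine_coord (y : V) : C := zcoord y + holo1 (xicoord y).

Let is_derive_affine x u :
  let X := xi_plane (Re (xicoord x)) (Im (xicoord x)) in
  is_derive x u (fun y => Re (affine_coord y))
    (Re (zcoord u) + (Re (xicoord u) * f1 X + Im (xicoord u) * f2 X)) /\
  is_derive x u (fun y => Im (affine_coord y))
    (Im (zcoord u) + (Re (xicoord u) * nf2 X + Im (xicoord u) * f1 X)).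
Proof.
move=> X; split.
  under eq_fun do rewrite /affine_coord cReD /=.
  exact: (is_deriveD (is_derive_linear_form x u linear_Re_z)
    (is_derive_C1_comp x u CA linear_Re_xi linear_Im_xi)).
under eq_fun do rewrite /affine_coord cImD /=.
exact: (is_deriveD (is_derive_linear_form x u linear_Im_z)
  (is_derive_C1_comp x u CB linear_Re_xi linear_Im_xi)).
Qed.

(** Completing the square: [inner_coord] is [c0] times the form of d(z + h1) plus [rho] times that
    of d xi, because h1' = (p - i q) / c0 produces the mixed terms and the excess of [r] over
    [rho]. *)
Theorem flat_kahler_form x u v : (kahler_form g x u v)%:C%C =
  'i%C * ((c0 / 2)%:C%C * wedge (cdiff affine_coord x)
                            (cdiff (fun y => Num.conj (affine_coord y)) x) u v
          + `|holo2 (xicoord x)| ^+ 2 * wedge (cdiff xicoord x)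
                            (cdiff (fun y => Num.conj (xicoord y)) x) u v).
Proof.
rewrite -add_Re2_Im2 -/(cnorm2 _) cnorm2_holo2 /wedge.
have [au1 au2] := is_derive_affine x u; have [av1 av2] := is_derive_affine x v.
have lR w := is_derive_linear_form x w linear_Re_xi.
have lI w := is_derive_linear_form x w linear_Im_xi.
rewrite !(cdiffE au1 au2) !(cdiffE av1 av2) !(cdiff_conj au1 au2) !(cdiff_conj av1 av2).
rewrite !(cdiffE (lR _) (lI _)) !(cdiff_conj (lR _) (lI _)).
have -> : f1 (xi_plane (Re (xicoord x)) (Im (xicoord x))) = c0^-1 * p x.
  by rewrite /f1 /p -inner_xi.
have Eq : f2 (xi_plane (Re (xicoord x)) (Im (xicoord x))) = c0^-1 * q x.
  by rewrite /f2 /q -inner_xi.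
rewrite /nf2 Eq /kahler_form inner_coord zcoordJ xicoordJ /rho.
move: (p x) (q x) (r x) => P Q S; move: (zcoord u) (xicoord u) => [a1 a2] [a3 a4].
move: (zcoord v) (xicoord v) => [b1 b2] [b3 b4].
have c0n : c0 != 0 by exact: lt0r_neq0.
apply: complex_eq; rewrite ?(cReD, cImD, cReN, cImN, cReM, cImM) /=; field => //.
Qed.

Theorem flat_kahler_classification :
  exists (c : R) (h1 h2 : C -> C),
    [/\ 0 < c, holomorphic h1, holomorphic h2, (forall z, h2 z != 0) &
     forall x u v, (kahler_form g x u v)%:C%C =
       'i%C * (c%:C%C * wedge (cdiff (fun y => zcoord y + h1 (xicoord y)) x)
           (cdiff (fun y => Num.conj (zcoord y + h1 (xicoord y))) x) u v
         + `|h2 (xicoord x)| ^+ 2 * wedge (cdiff xicoord x)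
           (cdiff (fun y => Num.conj (xicoord y)) x) u v)].
Proof.
exists (c0 / 2), holo1, holo2; split.
- by rewrite divr_gt0.
- exact: holomorphic_holo1.
- exact: holomorphic_holo2.
- move=> z; apply/eqP => E; have := cnorm2_exp (L (Re z) (Im z) +i* T (Re z) (Im z))%C.
  rewrite -/(holo2 z) E /cnorm2 /= expr0n addr0 => /eqP.
  by rewrite lt_eqF // expR_gt0.
- exact: flat_kahler_form.
Qed.

End FlatLineBundle.

Theorem proposition1p11 (R : realType) :
  (forall (n k : nat) (Gamma : set 'rV[R[i]]_(n - k))
      (H : 'I_k -> {hermitian 'rV[R[i]]_(n - k) for false & @Num.conj R[i]})
      (alpha : 'I_k -> 'rV[R[i]]_(n - k) -> R[i]),
    (k <= n)%N -> lattice Gamma ->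
    (forall p, appell_humbert Gamma (H p) (alpha p)) ->
    (exists g, complete_flat_kahler Gamma H alpha g) <->
    (forall p u v, H p u v = 0))
  /\
  (forall (Gamma : set 'rV[R[i]]_1)
      (H : {hermitian 'rV[R[i]]_1 for false & @Num.conj R[i]})
      (alpha : 'rV[R[i]]_1 -> R[i]),
    lattice Gamma -> appell_humbert Gamma H alpha ->
    forall g, complete_flat_kahler Gamma (fun _ : 'I_1 => H) (fun _ => alpha) g ->
    exists (c : R) (h1 h2 : R[i] -> R[i]),
      [/\ 0 < c, holomorphic h1, holomorphic h2, (forall w, h2 w != 0) &
       let z := fun x : 'rV[R]_((1 + 1) + (1 + 1)) => lsubmx (to_complex x) 0 0 in
       let xi := fun x : 'rV[R]_((1 + 1) + (1 + 1)) => rsubmx (to_complex x) 0 0 in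
       let f := fun x => z x + h1 (xi x) in
       forall x u v,
         (kahler_form g x u v)%:C%C =
         'i%C * (c%:C%C * wedge (cdiff f x) (cdiff (fun y => (f y)^*) x) u v
                 + `|h2 (xi x)| ^+ 2
                   * wedge (cdiff xi x) (cdiff (fun y => (xi y)^*) x) u v)]).
Proof.
split.
  move=> n k Gamma H alpha kn lG AH; split=> [[g cg]|H0].
    exact: hermitian_forms_vanish lG AH cg.
  by exists (@euclidean R _); exact: complete_flat_kahler_euclidean.
move=> Gamma H alpha lG AH g cg.
exact: flat_kahler_classification lG AH cg.
Qed.
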